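(* Let $k,m,b,r$ be positive integers with $k\le m$. Then there exists a positive integer $n_0$ with the following property. For every integer $n\ge n_0$ and every coloring of $\mathcal{U}_k(b^{<n})$ with $r$ colors, there exists $\mathbf{U}$ in $\mathcal{U}_m(b^{<n})$ such that the set $\mathcal{U}_k(\mathbf{U})$ is monochromatic.
   Context: Trees. For positive integers $b,n$, $b^{<n}$ is the set of all finite sequences with entries in $\{0,\dots,b-1\}$ of length less than $n$ (including the empty sequence). $|s|$ is the length of $s$, $s(i)$ its $i$-th entry ($0\le i<|s|$), $s^\frown(i)$ is $s$ extended by the entry $i$, $\sqsubseteq$ is the initial segment ordering (strict version $\sqsubset$). The lexicographical order: $s\le_{\mathrm{lex}}t$ iff either $s\sqsubseteq t$, or $s,t$ are $\sqsubseteq$-incomparable and $s(i)<t(i)$ where $i$ is the length of the longest common initial segment of $s,t$. A subtree of $b^{<n}$ is a subset $S\subseteq b^{<n}$ ordered by $\sqsubseteq$. For $s\in S$: $\mathrm{Pred}_S(s)=\{t\in S: t\sqsubset s\}$; $\mathrm{h}_S(s)=|\mathrm{Pred}_S(s)|$; $\mathrm{ImSucc}_S(s)$ is the set of $t\in S$ with $s\sqsubset t$ such that no $t'\in S$ satisfies $s\sqsubset t'\sqsubset t$. For a positive integer $k$, a $k$-complete skew subtree of $b^{<n}$ is a subtree $S$ such that: (i) $S$ has a $\sqsubseteq$-minimum and every $\sqsubseteq$-maximal chain of $S$ has cardinality $k$; (ii) if $s,s'\in S$, $\mathrm{h}_S(s)=\mathrm{h}_S(s')$ and $s\le_{\mathrm{lex}}s'$,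 then $|s|\le|s'|$; (iii) if $s,s'\in S$ and $\mathrm{h}_S(s)<\mathrm{h}_S(s')$, then $|s|<|s'|$; (iv) for every non-$\sqsubseteq$-maximal $s\in S$ and every $i\in\{0,\dots,b-1\}$ there is a unique $t\in\mathrm{ImSucc}_S(s)$ with $s^\frown(i)\sqsubseteq t$. Let $\mathcal{U}_1(b^{<n})$, as a set of subsets, denote the collection of all $U\subseteq b^{<n}$ having a $\sqsubseteq$-minimum, denoted $\min U$. For a positive integer $k$, $\mathcal{U}_k(b^{<n})$ is the set of all collections $(U_t)_{t\in T}$ of pairwise disjoint sets, where $T$ is a $k$-complete skew subtree of $b^{<n}$ and, for each $t\in T$, $U_t\subseteq b^{<n}$ has a $\sqsubseteq$-minimum with $\min U_t=t$ (for $k=1$ a collection with one member is identified with that member). $\mathcal{U}(b^{<n})=\bigcup_{k\ge1}\mathcal{U}_k(b^{<n})$. For $\mathbf{U},\mathbf{V}\in\mathcal{U}(b^{<n})$, $\mathbf{U}\le\mathbf{V}$ ($\mathbf{U}$ is a subspace of $\mathbf{V}$) means that every member of $\mathbf{U}$ is a union of members of $\mathbf{V}$. $\mathcal{U}_k(\mathbf{U})$ is the set of all $\mathbf{U}'\in\mathcal{U}_k(b^{<n})$ with $\mathbf{U}'\le\mathbf{U}$. *)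

(* Defs.v *)
From mathcomp Require Import all_boot.

Set Implicit Arguments.
Unset Strict Implicit.
Unset Printing Implicit Defensive.

(* b^{<n}; the bound in n.-bseq (size <= n) only serves to make the type
   finite. *)
Definition node (b n : nat) := {s : n.-bseq 'I_b | size s < n}.

Definition node_seq (b n : nat) (s : node b n) : seq 'I_b := val s.

Section Trees.
Variables b n : nat.
Implicit Types (s t : node b n) (S C U T : {set node b n}).

Definition len s : nat := size (node_seq s).

(* The default value 0 is never reached when i < len s. *)
Definition entry s (i : nat) : nat := nth 0 (map val (node_seq s)) i.

Definition ini s t : bool := prefix (node_seq s) (node_seq t).

Definition sini s t : bool := ini s t && (s != t).

Definition lcs s t : nat :=
  \max_(i < (len s).+1 | prefix (take i (node_seq s)) (node_seq t)) i.

(* If s and t are incomparable, then lcs s t < minn (len s) (len t), so both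
   entries are genuine. *)
Definition lexle s t : bool :=
  ini s t ||
  [&& ~~ ini s t, ~~ ini t s & entry s (lcs s t) < entry t (lcs s t)].

Definition Pred S s : {set node b n} := [set t in S | sini t s].

Definition height S s : nat := #|Pred S s|.

Definition ImSucc S s : {set node b n} :=
  [set t in S | sini s t && ~~ [exists t' in S, sini s t' && sini t' t]].

Definition is_min S s : Prop := s \in S /\ {in S, forall t, ini s t}.

Definition chain_of S C : bool :=
  (C \subset S) && [forall s in C, forall t in C, ini s t || ini t s].

(* s^(i) is formed as a plain sequence because it need not have length < n. *)
Record complete_skew (k : nat) (S : {set node b n}) : Prop := CompleteSkew {
  skew_min : exists s, is_min S s;
  skew_chain : forall C, maxset (chain_of S) C -> #|C| = k;
  skew_lex : {in S &, forall s s',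
    height S s = height S s' -> lexle s s' -> len s <= len s'};
  skew_level : {in S &, forall s s',
    height S s < height S s' -> len s < len s'};
  skew_succ : {in S, forall s, (exists2 t, t \in S & sini s t) ->
    forall i : 'I_b,
      exists! t, t \in ImSucc S s /\ prefix (rcons (node_seq s) i) (node_seq t)}
}.

(* A family (U_t)_{t in T} is represented by the set of its members: since
   min U_t = t, both T and the indexing are recovered from that set. *)
Definition in_U (k : nat) (P : {set {set node b n}}) : Prop :=
  exists (T : {set node b n}) (U : node b n -> {set node b n}),
    [/\ complete_skew k T,
        {in T, forall t, is_min (U t) t},
        {in T &, forall t t', t != t' -> [disjoint U t & U t']}
      & P = [set U t | t in T]].

Definition subspace (P Q : {set {set node b n}}) : Prop :=
  {in P, forall A, exists2 R : {set {set node b n}}, R \subset Q & A = cover R}.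

Definition in_U_of (k : nat) (Q P : {set {set node b n}}) : Prop :=
  in_U k P /\ subspace P Q.

End Trees.

(* Main.v *)
(* A member of U_k(b^{<n}) is encoded by labelling each node u of the tree with the minimum
   of the set containing u.  A colouring is simplified in two rounds of passing to a subspace.
   First, by the Hales-Jewett theorem along a path at each new tree node, the colour is made
   independent of the labels at all nodes that lie below no minimum.  The colour then only
   sees the labels and directions along the branches leading to the minima, that is, words over
   a finite alphabet, and a second use of Hales-Jewett makes it independent of the label and of
   the direction taken at every node that is not itself a minimum.  At that point only the set
   of heights of the minima matters, because skewness forces their order, and the classical
   Ramsey theorem for finite sets of heights concludes. *)
Require Import Defs.
From mathcomp Require Import all_boot.
From mathcomp Require Import zify.
From Stdlib Require Import FunctionalExtensionality Classical ClassicalEpsilon.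

Set Implicit Arguments.
Unset Strict Implicit.
Unset Printing Implicit Defensive.

(** * Finite Hales-Jewett and Ramsey theorems *)

(** The exits above a new tree node are read off a Hales-Jewett line, which is sought only after the
    colour has been simplified above them. So the cones above all words of one block length are
    treated beforehand as possible exits, and every size has to be bounded in terms of lengths
    alone, independently of the colouring and of the position. A letter names a label by the depth
    of an ancestor from which it is copied; the alphabet is then finite and the same for all cones
    at one depth. The variable of a line stands for the label of the new tree node, so moving along
    the line exchanges that label for any other letter. Skewness gives only weak inequalities
    between lengths on one level. They fix the order of the heights because the final space is built
    with raw lengths strictly increasing along the breadth-first order of its indices: a weak
    inequality inside it excludes the reverse order. *)

Definition fill (A : Type) (a : A) (l : seq (option A)) : seq A := map (odflt a) l.

Section HalesJewett.
Variable A : finType.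

(** Words use all of [A], but only the letters of [As] have to give one colour; the induction adds
    letters to [As] one at a time. *)
Definition line_on (C : Type) (As : seq A) (c : seq A -> C) (N : nat)
    (l : seq (option A)) : Prop :=
  [/\ size l = N, None \in l
    & {in As &, forall a a', c (fill a l) = c (fill a' l)}].

Definition focused (C : eqType) (a0 : A) (As : seq A) (c : seq A -> C) (N : nat)
    (w : seq A) (ls : seq (seq (option A) * C)) : Prop :=
  [/\ size w = N, uniq (unzip2 ls)
    & {in ls, forall p, [/\ size p.1 = N, None \in p.1, fill a0 p.1 = w
        & {in As, forall a, c (fill a p.1) = p.2}]}].

Lemma fill_cat a (l1 l2 : seq (option A)) : fill a (l1 ++ l2) = fill a l1 ++ fill a l2.
Proof. exact: map_cat. Qed.

Lemma fill_const a (w : seq A) : fill a (map Some w) = w.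
Proof. by rewrite /fill -map_comp map_id. Qed.

(* Colour focusing: either a monochromatic line or [s] lines, of distinct colours on
   [a1 :: As], that meet at the value [a0]. *)
Lemma hales_jewett_focus (a0 a1 : A) (As : seq A) (C : finType) (s : nat) :
  (forall C' : finType, exists N, forall c : seq A -> C',
     exists l, line_on (a1 :: As) c N l) ->
  exists N, forall c : seq A -> C,
    (exists l, line_on [:: a0, a1 & As] c N l) \/
    (exists w ls, size ls = s /\ focused a0 (a1 :: As) c N w ls).
Proof.
move=> HJ; elim: s => [|s [N IH]].
  by exists 0 => c; right; exists [::], [::].
(* The second block is coloured by the whole colouring that it induces on the first block, so its
   line [l'] works for every first block at once. *)
have [N' HN'] := HJ {ffun N.-tuple A -> C}.
exists (N + N') => c.
have [l' [sl' nl' cl']] :=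
  HN' (fun w' => [ffun w : N.-tuple A => c (tval w ++ w')]).
have cl w : size w = N -> {in a1 :: As &, forall a a',
    c (w ++ fill a l') = c (w ++ fill a' l')}.
  move=> sw a a' ha ha'; have := cl' a a' ha ha'.
  by move/eqP: sw => sw /ffunP /(_ (Tuple sw)); rewrite !ffunE.
pose w1 := fill a1 l'.
have extend l a : fill a (l ++ map Some w1) = fill a l ++ w1.
  by rewrite fill_cat fill_const.
have sext l : size l = N -> size (l ++ map Some w1) = N + N'.
  by move=> sl; rewrite size_cat !size_map sl sl'.
have a1in : a1 \in a1 :: As by rewrite mem_head.
case: (IH (fun w => c (w ++ w1))) => [[l [sl nl hl]]|[w [ls [sls [sw uls hls]]]]].
  left; exists (l ++ map Some w1); split; first exact: sext.
    by rewrite mem_cat nl.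
  by move=> a a' ha ha'; rewrite !extend; apply: hl.
(* If the focus has the colour of one of the lines, that line extends to [a0]. Otherwise its colour
   is new: the word [w] followed by [l'] becomes a further line, and all the others are prolonged
   along [l']. *)
have [/mapP[p pin pE]|new] := boolP (c (w ++ w1) \in unzip2 ls).
  have [sp np fp cp] := hls _ pin.
  left; exists (p.1 ++ map Some w1); split; first exact: sext.
    by rewrite mem_cat np.
  suff E a : a \in [:: a0, a1 & As] -> c (fill a (p.1 ++ map Some w1)) = p.2.
    by move=> a a' ha ha'; rewrite !E.
  by rewrite extend inE => /orP[/eqP->|/cp //]; rewrite fp -pE.
right; exists (w ++ fill a0 l'),
  ((map Some w ++ l', c (w ++ w1)) :: [seq (p.1 ++ l', p.2) | p <- ls]).
split; first by rewrite /= size_map sls.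
split; first by rewrite size_cat sw size_map sl'.
  by rewrite /= /unzip2 -map_comp (eq_map (g := snd)) ?new.
move=> p; rewrite inE => /orP[/eqP->|/mapP[q qin ->]] /=.
  split; rewrite ?size_cat ?size_map ?sw ?sl' // ?mem_cat ?nl' ?orbT //.
    by rewrite fill_cat fill_const.
  by move=> a ha; rewrite fill_cat fill_const (cl w sw a a1).
have [sq nq fq cq] := hls _ qin.
split; rewrite ?size_cat ?sq ?sl' // ?mem_cat ?nq //; first by rewrite fill_cat fq.
move=> a ha; rewrite fill_cat (cl _ _ a a1) ?size_map //; exact: cq.
Qed.

Lemma hales_jewett_on (As : seq A) (C : finType) :
  exists N, forall c : seq A -> C, exists l, line_on As c N l.
Proof.
elim: As C => [|a0 [|a1 As] IH] C.
- by exists 1 => c; exists [:: None].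
- exists 1 => c; exists [:: None]; split=> // a a'.
  by rewrite !inE => /eqP-> /eqP->.
(* More focused lines than colours cannot exist, which leaves the monochromatic line. *)
have [N HN] := hales_jewett_focus a0 C #|C|.+1 IH.
exists N => c; case: (HN c) => // -[w [ls [sls [_ uls _]]]].
have := card_uniqP uls; rewrite size_map sls => E.
by have := max_card (mem (unzip2 ls)); rewrite E ltnn.
Qed.

Lemma hales_jewett (C : finType) :
  exists N, forall c : seq A -> C, exists l : seq (option A),
    [/\ size l = N, None \in l & forall a a', c (fill a l) = c (fill a' l)].
Proof.
have [N HN] := hales_jewett_on (enum A) C.
exists N => c; have [l [sl nl hl]] := HN c.
by exists l; split=> // a a'; apply: hl; rewrite mem_enum.
Qed.

End HalesJewett.

(** * Ramsey's theorem through end-homogeneous sequences *)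

Section Ramsey.
Variable C : finType.
Implicit Types (s t u : seq nat) (c : seq nat -> C).

Definition head_color K c (a : C) x t : Prop :=
  forall u, subseq u t -> size u = K -> c (x :: u) = a.

(** Erdős-Rado end-homogeneity: the colour of a subsequence of length [K.+1] depends only on the
    term that it starts with. *)
Fixpoint end_homogeneous K c t : Prop :=
  if t is x :: t' then (exists a, head_color K c a x t') /\ end_homogeneous K c t'
  else True.

Fixpoint end_monochromatic K c a t : Prop :=
  if t is x :: t' then head_color K c a x t' /\ end_monochromatic K c a t'
  else True.

Lemma end_monochromaticP K c a t : end_monochromatic K c a t ->
  forall u, subseq u t -> size u = K.+1 -> c u = a.
Proof.
elim: t => [|x t IH] /=; first by move=> _ [|].
case=> hx /IH{}IH [|y u] //= hs [su].
by move: hs; case: eqP => [->|_] hs; [apply: hx | apply: IH; rewrite /= ?su].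
Qed.

(** Each term goes to the class of the colour of the subsequences that it heads. The classes share
    out the terms of [t], which prepares the pigeonhole argument. *)
Lemma end_homogeneous_split K c t : end_homogeneous K c t ->
  exists ts : C -> seq nat,
    (forall a, subseq (ts a) t /\ end_monochromatic K c a (ts a)) /\
    \sum_a size (ts a) = size t.
Proof.
elim: t => [|x t IH] /= => [_|[[a ha] /IH [ts [hts sts]]]].
  by exists (fun=> [::]); split=> //; rewrite big1.
exists (fun a' => if a' == a then x :: ts a' else ts a'); split=> [a'|].
  have [h1 h2] := hts a'; case: eqP => [E|_] /=; last first.
    by split=> //; apply: subseq_trans h1 (subseq_cons _ _).
  rewrite eqxx; split=> //; split=> // u su; rewrite E; apply: ha.
  exact: subseq_trans su h1.
rewrite (bigD1 a) //= eqxx /= -sts (bigD1 a (F := fun i => size (ts i))) //= addSn.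
by congr (_ + _).+1; apply: eq_bigr => i /negPf->.
Qed.

Lemma subseq_take n (t : seq nat) : subseq (take n t) t.
Proof. by rewrite -{2}(cat_take_drop n t) prefix_subseq. Qed.

Lemma finite_ramsey K M : exists N, forall s c, N <= size s ->
  exists t, [/\ subseq t s, size t = M & forall u u', subseq u t -> subseq u' t ->
    size u = K -> size u' = K -> c u = c u'].
Proof.
elim: K M => [|K IH] M.
  exists M => s c Ms; exists (take M s); rewrite subseq_take size_takel //.
  by split=> // -[|? ?] [|? ?].
have prehom M' : exists N, forall s c, N <= size s ->
    exists t, [/\ subseq t s, size t = M' & end_homogeneous K c t].
  elim: M' => [|M' [N HN]]; first by exists 0 => s c _; exists [::]; rewrite sub0seq.
  have [N' HN'] := IH N; exists N'.+1 => -[|x s] // c /= hs.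
  have [t1 [st1 zt1 ht1]] := HN' s (fun u => c (x :: u)) hs.
  have [t [st zt ht]] := HN t1 c (eq_leq (esym zt1)).
  exists (x :: t); split; rewrite /= ?eqxx ?zt ?(subseq_trans st st1) //; split=> //.
  exists (c (x :: take K t)) => u su zu.
  have Kt : K <= size t by rewrite -zu size_subseq.
  by apply: ht1; rewrite ?size_takel ?(subseq_trans _ st) ?subseq_take.
(* One term more than [#|C|] classes of size [M] can hold. *)
have [N HN] := prehom (#|C| * M).+1; exists N => s c hs.
have [t [st zt /end_homogeneous_split [ts [hts sts]]]] := HN s c hs.
have [a Ma] : exists a, M <= size (ts a).
  apply/existsP; apply: contraT; rewrite negb_exists => /forallP small.
  have : \sum_a size (ts a) <= \sum_(a : C) M.
    by apply: leq_sum => a _; have := small a; rewrite -ltnNge => /ltnW.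
  by rewrite sts zt sum_nat_const ltnn.
have [s1 /end_monochromaticP mono] := hts a.
exists (take M (ts a)); split; last first.
- move=> u u' su su' zu zu'.
  by rewrite !mono // (subseq_trans _ (subseq_take M _)).
- by rewrite size_takel.
by apply: subseq_trans (subseq_take _ _) (subseq_trans s1 st).
Qed.

End Ramsey.

(** * Configurations and subspaces *)

Section Prefixes.
Variable A : eqType.
Implicit Types (u v w x : seq A) (i j : A).

Lemma prefix_total u v w : prefix u w -> prefix v w -> prefix u v || prefix v u.
Proof.
elim: w u v => [|z w IH] u v; first by rewrite prefixs0 => /eqP->; rewrite prefix0s.
case: u v => [|x u] [|y v] //=; rewrite ?prefix0s //.
move=> /andP[/eqP-> hu] /andP[/eqP-> hv]; rewrite !eqxx; exact: IH.
Qed.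

Lemma prefix_size_eq u v : prefix u v -> size v <= size u -> u = v.
Proof. by rewrite prefixE => /eqP E h; rewrite -E take_oversize. Qed.

Lemma prefix_anti u v : prefix u v -> prefix v u -> u = v.
Proof. by move=> h /size_prefix; apply: prefix_size_eq. Qed.

Lemma prefix_rconsE u v i : prefix u (rcons v i) = (u == rcons v i) || prefix u v.
Proof.
elim: v u => [|y v IH] [|x u]; rewrite /= ?orbT // ?eqseq_cons.
  by case: u; rewrite ?andbT ?andbF ?orbF.
by rewrite IH andb_orr.
Qed.

Lemma prefix_strict u v : prefix u v -> u != v -> exists i, prefix (rcons u i) v.
Proof.
case/prefixP=> -[|i w] ->; first by rewrite cats0 eqxx.
by exists i; rewrite -cat_rcons prefix_prefix.
Qed.

Lemma prefix_rcons_inj u i j w : prefix (rcons u i) w -> prefix (rcons u j) w -> i = j.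
Proof.
move=> hi hj; have := prefix_total hi hj.
by case/orP=> /prefix_size_eq; rewrite !size_rcons => /(_ (leqnn _)) /rcons_inj[].
Qed.

Lemma prefix_split v w : [\/ prefix v w, prefix w v |
  exists x i j, [/\ i != j, prefix (rcons x i) v & prefix (rcons x j) w]].
Proof.
elim: v w => [|y v IH] w; first by constructor 1; rewrite prefix0s.
case: w => [|z w]; first by constructor 2.
have [<-|ne] := eqVneq y z; last by constructor 3; exists [::], y, z; split; rewrite //= eqxx prefix0s.
case: (IH w) => [h|h|[x [i [j [ne h h']]]]]; [constructor 1|constructor 2|constructor 3].
- by rewrite /= eqxx.
- by rewrite /= eqxx.
by exists (y :: x), i, j; split; rewrite //= eqxx.
Qed.

Lemma prefix_cat2 u v w : prefix (u ++ v) (u ++ w) = prefix v w.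
Proof. by rewrite prefix_catr ?eqxx. Qed.

Lemma prefix_dropK u v : prefix u v -> u ++ drop (size u) v = v.
Proof. by case/prefixP=> w ->; rewrite drop_size_cat. Qed.

End Prefixes.

(** * Configurations over the infinite tree, and subspaces acting on them *)

Section Spaces.
Variables (b : nat) (C : finType).
Notation T := (seq 'I_b.+1).

(* [f u = Some s] records that u lies in the member with minimum s. *)
Definition conf := T -> option T.
Implicit Types (u v w e s : T) (f g : conf) (D : pred T) (tau : T -> T)
  (G : T -> option T) (c : conf -> C).

Definition valid f : Prop := forall u s, f u = Some s -> prefix s u /\ f s = Some s.

Definition supp D f : Prop := forall u, f u -> D u.

Definition clear f u : Prop := forall s, prefix u s -> f s <> Some s.

Definition off_path f g : Prop := forall u, f u = g u \/ (clear f u /\ clear g u).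

Definition agree_out D f g : Prop := forall u, ~~ D u -> f u = g u.

Definition agree_in D f g : Prop := forall u, D u -> f u = g u.

Definition down_closed D : Prop := forall v w, D w -> prefix v w -> D v.

(** Directions are preserved at single steps; this propagates along branches, and since diverging
    nodes then have diverging images the prefix order is also reflected. *)
Definition stepwise D tau : Prop :=
  forall v i, D (rcons v i) -> prefix (rcons (tau v) i) (tau (rcons v i)).

Section Stepwise.
Variables (D : pred T) (tau : T -> T).
Hypotheses (down : down_closed D) (step : stepwise D tau).

Lemma step_mono v w : D w -> prefix v w -> prefix (tau v) (tau w).
Proof.
elim/last_ind: w => [|w i IH] Dw; first by rewrite prefixs0 => /eqP->; apply: prefix_refl.
rewrite prefix_rconsE => /orP[/eqP->|]; first exact: prefix_refl.
move/IH => h; have := step Dw; apply: prefix_trans.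
apply: (prefix_trans _ (prefix_rcons _ _)); apply: h.
by apply: down Dw _; apply: prefix_rcons.
Qed.

Lemma step_mono_rcons v i w : D w -> prefix (rcons v i) w ->
  prefix (rcons (tau v) i) (tau w).
Proof.
by move=> Dw h; apply: prefix_trans (step_mono Dw h); apply: step; apply: down Dw h.
Qed.

Lemma step_reflect v w : D v -> D w -> prefix (tau v) (tau w) -> prefix v w.
Proof.
move=> Dv Dw h; case: (prefix_split v w) => // [h'|[x [i [j [ne hi hj]]]]].
  have [->|ne] := eqVneq w v; first exact: prefix_refl.
  have [i hi] := prefix_strict h' ne; have := size_prefix (prefix_trans (step_mono_rcons Dv hi) h).
  by rewrite size_rcons ltnn.
have h1 := prefix_trans (step_mono_rcons Dv hi) h.
by rewrite (prefix_rcons_inj h1 (step_mono_rcons Dw hj)) eqxx in ne.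
Qed.

Lemma step_inj v w : D v -> D w -> tau v = tau w -> v = w.
Proof.
by move=> Dv Dw E; apply: prefix_anti; apply: step_reflect => //; rewrite E prefix_refl.
Qed.

End Stepwise.

(** A subspace with members indexed by [D]: [tau v] is the minimum of the member of index [v], and
    [G u = Some v] puts the raw node [u] into it. Raw nodes may belong to no member. *)
Record space D D' tau G : Prop := Space {
  space_down : down_closed D;
  space_step : stepwise D tau;
  space_mem : forall u v, G u = Some v -> D v -> D' u /\ prefix (tau v) u;
  space_fix : forall v, D v -> G (tau v) = Some v;
  space_dom : forall u v, G u = Some v -> D v }.

Definition guard D G u : option T :=
  if G u is Some v then if D v then Some v else None else None.

(** A configuration [f] of the indices merges members of the space; its raw form gives [u] the label
    of its index, carried over by [tau]. Composition of spaces thus corresponds to passing to a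
    subspace of a subspace. *)
Definition act tau G f : conf := fun u => if G u is Some v then omap tau (f v) else None.

Lemma guard_space D D' tau G :
  down_closed D -> stepwise D tau ->
  (forall u v, G u = Some v -> D v -> D' u /\ prefix (tau v) u) ->
  (forall v, D v -> G (tau v) = Some v) ->
  space D D' tau (guard D G).
Proof.
move=> h1 h2 h3 h4; split=> //; rewrite /guard.
- by move=> u v; case E: (G u) => [w|] //; case: ifP => // _ [<-]; apply: h3.
- by move=> v Dv; rewrite h4 ?Dv.
by move=> u v; case E: (G u) => [w|] //; case: ifP => // Dw [<-].
Qed.

Lemma act_guard D tau G f : supp D f -> act tau (guard D G) f = act tau G f.
Proof.
move=> sf; apply: functional_extensionality => u; rewrite /act /guard.
case: (G u) => // v; case: ifP => // nD.
by case E: (f v) => //; have := sf v; rewrite E nD => /(_ isT).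
Qed.

Section OneSpace.
Variables (D D' : pred T) (tau : T -> T) (G : T -> option T).
Hypothesis sp : space D D' tau G.

Definition space_mono := step_mono (space_down sp) (space_step sp).
Definition space_mono_rcons := step_mono_rcons (space_down sp) (space_step sp).
Definition space_reflect := step_reflect (space_down sp) (space_step sp).

Lemma space_raw v : D v -> D' (tau v).
Proof. by move=> Dv; case: (space_mem sp (space_fix sp Dv) Dv). Qed.

Lemma act_supp f : supp D' (act tau G f).
Proof.
move=> u; rewrite /act; case E: (G u) => [v|] // _.
by case: (space_mem sp E) => //; apply: (space_dom sp) E.
Qed.

Lemma act_valid f : valid f -> valid (act tau G f).
Proof.
move=> vf u s'; rewrite /act; case E: (G u) => [v|] //.
case F: (f v) => [s|] // [<-]; have [sv fs] := vf _ _ F.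
have Dv := space_dom sp E; have [_ tu] := space_mem sp E Dv.
split; first by apply: prefix_trans tu; apply: space_mono.
by rewrite (space_fix sp) ?fs //; apply: (space_down sp) Dv sv.
Qed.

Lemma act_top f u : valid f -> act tau G f u = Some u ->
  exists s, [/\ D s, u = tau s & f s = Some s].
Proof.
move=> vf; rewrite /act; case E: (G u) => [v|] //.
case F: (f v) => [s|] // [Es]; have [sv fs] := vf _ _ F.
by exists s; split=> //; apply: (space_down sp) sv; apply: (space_dom sp) E.
Qed.

Lemma act_tau f v : D v -> act tau G f (tau v) = omap tau (f v).
Proof. by move=> Dv; rewrite /act (space_fix sp). Qed.

Lemma act_clear f u v : valid f -> G u = Some v -> clear f v -> clear (act tau G f) u.
Proof.
move=> vf E cl s us /(act_top vf)[s' [Ds' Es fs']]; apply: cl fs'.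
have Dv := space_dom sp E; apply: space_reflect => //.
by rewrite -Es; apply: prefix_trans us; case: (space_mem sp E Dv).
Qed.

Lemma act_off_path f g : valid f -> valid g -> off_path f g ->
  off_path (act tau G f) (act tau G g).
Proof.
move=> vf vg h u; rewrite {1 2}/act.
case E: (G u) => [v|]; last by left.
case: (h v) => [->|[cf cg]]; first by left.
by right; split; apply: act_clear E _.
Qed.

End OneSpace.

Lemma comp_space D1 D2 D3 tau1 G1 tau2 G2 :
  space D1 D2 tau2 G2 -> space D2 D3 tau1 G1 ->
  space D1 D3 (tau1 \o tau2) (fun u => obind G2 (G1 u)).
Proof.
move=> s2 s1; split.
- exact: space_down s2.
- move=> v i Dv /=; apply: (space_mono_rcons s1); first exact: (space_raw s2).
  exact: (space_step s2).
- move=> u v; case E: (G1 u) => [w|] //= E' Dv; have [Dw h] := space_mem s2 E' Dv.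
  have [D3u h'] := space_mem s1 E Dw; split=> //.
  by apply: prefix_trans h'; apply: (space_mono s1).
- by move=> v Dv /=; rewrite (space_fix s1) ?(space_raw s2) //= (space_fix s2).
by move=> u v; case E: (G1 u) => [w|] //=; apply: (space_dom s2).
Qed.

Lemma act_comp tau1 G1 tau2 G2 f :
  act (tau1 \o tau2) (fun u => obind G2 (G1 u)) f = act tau1 G1 (act tau2 G2 f).
Proof.
apply: functional_extensionality => u; rewrite /act.
by case: (G1 u) => //= w; case: (G2 w) => //= v; case: (f v).
Qed.

Section Codes.
Variables (K h : nat).

(** A label is a prefix of the node that carries it, hence determined by its length. So the contents
    of a cone of height [h] form a finite type that depends on the root only through the bound [K]
    on its length. *)
Definition code : finType := {ffun h.-bseq 'I_b.+1 -> option 'I_(K + h)}.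

Definition decode e (a : code) u : option T :=
  if prefix e u && (size u < size e + h) then
    if insub (drop (size e) u) is Some v then omap (fun j : 'I__ => take j u) (a v)
    else None
  else None.

Lemma decodeP e f : valid f -> size e <= K -> exists a : code, forall u, prefix e u ->
  decode e a u = if size u < size e + h then f u else None.
Proof.
move=> vf Ke; exists [ffun v : h.-bseq _ => obind (fun s => insub (size s)) (f (e ++ v))].
move=> u eu; rewrite /decode eu /=; case: ifP => // hu.
have hd : size (drop (size e) u) <= h by rewrite size_drop leq_subLR ltnW.
rewrite insubT /= ffunE /= prefix_dropK //.
case E: (f u) => [s|] //=; have [su _] := vf _ _ E.
have hs : size s < K + h by rewrite (leq_ltn_trans (size_prefix su)) ?(leq_trans hu) ?leq_add2r.
by rewrite insubT /=; move: su; rewrite prefixE => /eqP->.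
Qed.

End Codes.

End Spaces.

(** * Ramsey statements at a cone and along a forest *)

Section Cones.
Variables (b : nat) (C : finType).
Notation T := (seq 'I_b.+1).
Notation conf := (conf b).
Implicit Types (u v w e s : T) (es : seq T) (f g : conf) (D P Q : pred T) (tau : T -> T)
  (G : T -> option T) (c : conf -> C).

(** Only the cone of [e] is truncated. Everything else stays, so that several cones can be treated
    one after the other. *)
Definition cdom e h v : bool := ~~ prefix e v || (size v < size e + h).

Definition fdom es h v : bool := all (fun e => cdom e h v) es.

Definition covered es u : bool := has (fun e => prefix e u) es.

Definition ident P tau G : Prop := forall u, ~~ P u -> tau u = u /\ G u = Some u.

Definition keeps es D tau : Prop :=
  forall e v, e \in es -> D v -> prefix e v -> prefix e (tau v).

Definition lab_mono (lab : T -> nat) : Prop := forall u v, prefix u v -> lab u <= lab v.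

Definition incomparable es : bool :=
  pairwise (fun e e' => ~~ prefix e e' && ~~ prefix e' e) es.

Lemma cdom_down e h : down_closed (cdom e h).
Proof.
move=> v w; rewrite /cdom => hw vw; case ev: (prefix e v) => //=.
by move: hw; rewrite (prefix_trans ev vw) /=; apply: leq_ltn_trans (size_prefix vw).
Qed.

Lemma fdom_down es h : down_closed (fdom es h).
Proof. by move=> v w /allP hw vw; apply/allP=> e /hw /cdom_down; apply. Qed.

Lemma cdom_leq e h h' v : h <= h' -> cdom e h v -> cdom e h' v.
Proof. by rewrite /cdom => hh /orP[->//|lt]; apply/orP; right; lia. Qed.

Lemma covered_up es u v : prefix u v -> covered es u -> covered es v.
Proof. by move=> uv /hasP[e ein eu]; apply/hasP; exists e => //; apply: prefix_trans uv. Qed.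

Lemma incomparableP es e e' u : incomparable es -> e \in es -> e' \in es ->
  prefix e u -> prefix e' u -> e = e'.
Proof.
elim: es => //= x es IH /andP[/allP hx hes]; rewrite !inE.
have no y : y \in es -> prefix x u -> prefix y u -> False.
  by move=> /hx /andP[/negPf n1 /negPf n2] /prefix_total h /h; rewrite n1 n2.
case/predU1P=> [->|ein] /predU1P[->|e'in] // hu hu'.
- by case: (no e').
- by case: (no e).
exact: IH.
Qed.

Lemma nth_leq_sumn (ls : seq nat) k : nth 0 ls k <= sumn ls.
Proof.
elim: ls k => [|l ls IH] [|k] //=; first exact: leq_addr.
by apply: leq_trans (IH k) _; apply: leq_addl.
Qed.

Lemma restrict_space D D' Q Q' tau G : space D D' tau G ->
  down_closed Q -> (forall v, Q v -> D v) ->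
  (forall u v, G u = Some v -> Q v -> Q' u) -> space Q Q' tau (guard Q G).
Proof.
move=> sp hQ QD hG; apply: guard_space => //.
- by move=> v i /QD; apply: (space_step sp).
- move=> u v E Qv; split; first exact: hG E Qv.
  by case: (space_mem sp E (QD _ Qv)).
by move=> v /QD; apply: (space_fix sp).
Qed.

Lemma act_ident P tau G f u : ident P tau G -> (forall v w, prefix v w -> P v -> P w) ->
  valid f -> ~~ P u -> act tau G f u = f u.
Proof.
move=> id up vf Pu; rewrite /act (id u Pu).2.
case E: (f u) => [s|] //=; have [su _] := vf _ _ E.
by rewrite (id s _).1 //; apply: contra Pu; apply: up.
Qed.

Section Theorems.
Variables (R : T -> nat -> conf -> conf -> Prop) (Good : (conf -> C) -> Prop).

(* The configurations outside the cone of [e] range over the finite family [zs], and the size N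
   does not depend on [e] beyond its length [l].  The function [lab] grades the raw nodes so that
   the tree node of height d in the cone has grade d; lengths alone do not, since the subtrees
   above different exits have unrelated sizes. *)
Definition cone_theorem h : Prop := forall (l : nat) (X : finType),
  exists N lab, lab_mono lab /\ forall e, size e = l ->
  forall (zs : X -> conf) c, Good c -> exists tau G,
  [/\ space (cdom e h) (cdom e N) tau G, ident (prefix e) tau G,
      keeps [:: e] (cdom e h) tau,
      forall v, size v < h -> lab (drop l (tau (e ++ v))) = size v
    & forall x f f', valid f -> valid f' -> supp (cdom e h) f -> supp (cdom e h) f' ->
      agree_out (prefix e) f (zs x) -> agree_out (prefix e) f' (zs x) ->
      R e h f f' -> c (act tau G f) = c (act tau G f')].

Definition forest_theorem h : Prop := forall (ls : seq nat) (X : finType),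
  exists N labs, (forall k : nat, lab_mono (labs k)) /\
  forall es, map size es = ls -> incomparable es ->
  forall (zs : X -> conf) c, Good c -> exists tau G,
  [/\ space (fdom es h) (fdom es N) tau G, ident (covered es) tau G,
      keeps es (fdom es h) tau,
      forall k v, k < size es -> size v < h ->
        labs k (drop (size (nth [::] es k)) (tau (nth [::] es k ++ v))) = size v
    & forall x f f', valid f -> valid f' -> supp (fdom es h) f -> supp (fdom es h) f' ->
      agree_out (covered es) f (zs x) -> agree_out (covered es) f' (zs x) ->
      {in es, forall e, R e h f f'} -> c (act tau G f) = c (act tau G f')].

Hypothesis R_local : forall e h f f' g g', agree_in (prefix e) f g ->
  agree_in (prefix e) f' g' -> R e h f f' -> R e h g g'.
Hypothesis Good_act : forall c D D' tau G, space D D' tau G -> Good c ->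
  Good (fun f => c (act tau G f)).

(* The first cone is treated first, with the raw contents of the other cones as parameters; the
   other cones are then treated with the already reduced content of the first one as a parameter.
   Its number of values depends on [h] only, which avoids a circular choice of sizes. *)
Lemma cone_to_forest h : cone_theorem h -> forest_theorem h.
Proof.
move=> cone; elim=> [|l ls IH] X.
  exists 0, (fun _ _ => 0); split=> [//|] [|//] _ _ zs c _; exists id, Some; split=> //.
    by split=> //= [v i _|u v [->] _]; rewrite ?prefix_refl.
  move=> x f f' vf vf' _ _ hf hf' _; congr (c (act _ _ _)).
  by apply: functional_extensionality => u; rewrite hf ?hf'.
have [N' [labs' [mono' IH']]] := IH (X * code b l h)%type.
(* [sumn ls] is a common bound for the lengths of the other roots, as [code] requires one. *)
have [N0 [lab0 [mono0 cone']]] :=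
  cone l (X * {ffun 'I_(size ls) -> code b (sumn ls) N'})%type.
exists (maxn N0 N'), (fun k => if k is k'.+1 then labs' k' else lab0).
split=> [[//|k]|]; first exact: mono'.
case=> // e es [se ses] /= /andP[/allP inc_e inc] zs c Gc.
have size_es : size es = size ls by rewrite -ses size_map.
have sep u : prefix e u -> ~~ covered es u.
  move=> eu; apply/hasPn=> e' /inc_e /andP[n1 n2]; apply/negP=> /(prefix_total eu).
  by rewrite (negPf n1) (negPf n2).
pose zs1 (p : X * {ffun 'I_(size ls) -> code b (sumn ls) N'}) u :=
  let k := find (fun e' => prefix e' u) es in
  if insub k is Some i then decode (nth [::] es k) (p.2 i) u else zs p.1 u.
have [tau0 [G0 [sp0 id0 keep0 hlab0 col0]]] := cone' e se zs1 c Gc.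
pose zs2 (p : X * code b l h) u := if prefix e u then decode e p.2 u else zs p.1 u.
have [tau' [G' [sp' id' keep' hlab' col']]] := IH' es ses inc zs2 _ (Good_act sp0 Gc).
pose D1 := fdom (e :: es) h; pose D3 := fdom (e :: es) (maxn N0 N').
(* Intermediate stage of the composition: the first cone still has index height [h], the others are
   already raw up to [N']. *)
pose D2 u := cdom e h u && fdom es N' u.
have D2_down v w : D2 w -> prefix v w -> D2 v.
  by case/andP=> h1 h2 vw; rewrite /D2 (cdom_down h1 vw) (fdom_down h2 vw).
have spl : space D1 D2 tau' (guard D1 G').
  apply: (restrict_space sp') => [v w|v /andP[]//|u v E /andP[h1 h2]].
    exact: fdom_down.
  have [h3 _] := space_mem sp' E h2; apply/andP; split=> //.
  rewrite /cdom; case eu: (prefix e u) => //=.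
  by move: E h1; rewrite (id' _ (sep _ eu)).2 => -[<-]; rewrite /cdom eu.
have spr : space D2 D3 tau0 (guard D2 G0).
  apply: (restrict_space sp0 D2_down) => [v /andP[]//|u v E /andP[h1 /allP h2]].
  have [h3 _] := space_mem sp0 E h1; apply/andP; split.
    by apply: (cdom_leq _ h3); rewrite leq_maxl.
  apply/allP=> e' e'in; rewrite /cdom; case eu: (prefix e' u) => //=.
  have neu : ~~ prefix e u by apply: contraL eu => /sep /hasPn; apply.
  move: E; rewrite (id0 _ neu).2 => -[E]; have := h2 _ e'in.
  by rewrite -E /cdom eu /=; lia.
have sp := comp_space spl spr.
have act_eq f : supp D1 f -> act (tau0 \o tau')
    (fun u => obind (guard D1 G') (guard D2 G0 u)) f = act tau0 G0 (act tau' G' f).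
  move=> sf; have := act_supp spl (f := f).
  by rewrite act_comp (act_guard _ _ sf); apply: act_guard.
have cov_up := @covered_up es.
have id_act f u : valid f -> ~~ covered es u -> act tau' G' f u = f u.
  by move=> vf; exact: (act_ident id' cov_up vf).
exists (tau0 \o tau'), (fun u => obind (guard D1 G') (guard D2 G0 u)); split=> //.
- move=> u; rewrite /= negb_or => /andP[neu nes] /=.
  rewrite (id' _ nes).1 (id0 _ neu).1; split=> //.
  have nD N : fdom es N u by apply/allP=> e' /(hasPn nes) n'; rewrite /cdom n'.
  have D2u : D2 u by rewrite /D2 nD /cdom neu.
  have D1u : D1 u by rewrite /D1 /= nD /cdom neu.
  by rewrite {2}/guard (id0 _ neu).2 D2u /= /guard (id' _ nes).2 D1u.
- move=> e' v; rewrite inE => /orP[/eqP->|e'in] /andP[D1v D1v'] e'v /=.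
    have nv := sep _ e'v; rewrite (id' _ nv).1.
    by apply: keep0 => //; rewrite mem_head.
  have h1 := keep' _ _ e'in D1v' e'v.
  rewrite (id0 _ _).1 //; apply: contraL h1 => /sep /hasPn; exact.
- case=> [|k] v /= hk hv.
    by rewrite (id' _ _).1 ?se ?hlab0 // sep ?prefix_prefix.
  have e'in : nth [::] es k \in es by apply: mem_nth.
  have h1 : prefix (nth [::] es k) (tau' (nth [::] es k ++ v)).
    apply: keep' => //; last exact: prefix_prefix.
    apply/allP=> e2 e2in; rewrite /cdom; case h2: (prefix e2 _) => //=.
    by rewrite (incomparableP inc e2in e'in h2) ?prefix_prefix // size_cat; lia.
  rewrite (id0 _ _).1 ?hlab' //; apply: contraL h1 => /sep /hasPn; exact.
move=> x f f' vf vf' sf sf' hf hf' hR; rewrite !act_eq //.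
(* Hybrid of both configurations: the content of the first cone is exchanged first, that of the
   other cones afterwards. *)
pose z1 u := if prefix e u then f' u else f u.
have vz : valid z1.
  move=> u s; rewrite /z1; case: ifPn => eu E.
    have [su fs] := vf' _ _ E; split=> //; case: ifPn => es' //.
    have ns : ~~ covered (e :: es) s.
      by rewrite /= (negPf es') /=; apply: contra (sep _ eu); apply: covered_up.
    by rewrite hf // -hf'.
  have [su fs] := vf _ _ E; split=> //.
  by case: ifPn => // es'; rewrite (prefix_trans es' su) in eu.
have sz : supp D1 z1 by move=> u; rewrite /z1; case: ifP => _; [apply: sf'|apply: sf].
have v1 := act_valid sp' vf; have v2 := act_valid sp' vz.
transitivity (c (act tau0 G0 (act tau' G' z1))).
  have [g hg] : exists g : {ffun 'I_(size ls) -> code b (sumn ls) N'}, forall (k : 'I_(size ls)) u,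
      prefix (nth [::] es k) u -> decode (nth [::] es k) (g k) u =
      if size u < size (nth [::] es k) + N' then act tau' G' f u else None.
    have /fin_all_exists[g hg] : forall k : 'I_(size ls), exists a : code b (sumn ls) N',
       forall u, prefix (nth [::] es k) u -> decode (nth [::] es k) a u =
       if size u < size (nth [::] es k) + N' then act tau' G' f u else None.
      move=> k; apply: decodeP => //.
      have kes : k < size es by rewrite size_es.
      have := nth_leq_sumn (map size es) k.
      by rewrite (nth_map [::]) // ses.
    by exists (finfun g) => k u ku; rewrite ffunE hg.
  have out u : ~~ prefix e u -> act tau' G' f u = zs1 (x, g) u.
    move=> neu; rewrite /zs1 /=; set k := find _ es.
    have [cov|ncov] := boolP (covered es u); last first.
      have kE : k = size es by apply/eqP; rewrite eqn_leq find_size /= leqNgt -has_find.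
      by rewrite insubF ?id_act ?hf //= ?negb_or ?neu // kE size_es ltnn.
    have klt : k < size ls by rewrite -size_es -has_find.
    rewrite insubT /= (hg (Ordinal klt)) /=; last exact: (nth_find [::] cov).
    case: ifP => // nsz; case E: (act tau' G' f u) => // .
    have := act_supp sp' (f := f) (u := u); rewrite E => /(_ isT) /allP /(_ (nth [::] es k)).
    by rewrite mem_nth ?size_es // /cdom (nth_find [::] cov) nsz => /(_ isT).
  have same u : ~~ prefix e u -> act tau' G' z1 u = act tau' G' f u.
    move=> neu; rewrite /act; case E: (G' u) => [v|] //.
    rewrite /z1; case: ifPn => // ev.
    have [_] := space_mem sp' E (space_dom sp' E).
    by rewrite (id' _ (sep _ ev)).1 => /(prefix_trans ev); rewrite (negPf neu).
  have inn f1 : valid f1 -> agree_in (prefix e) f1 (act tau' G' f1).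
    by move=> vf1 u eu; rewrite id_act // sep.
  have sup f1 : valid f1 -> supp D1 f1 -> supp (cdom e h) (act tau' G' f1).
    move=> vf1 sf1 u; rewrite /cdom; case eu: (prefix e u) => //=.
    by rewrite id_act ?sep // => /sf1 /andP[]; rewrite /cdom eu.
  apply: (col0 (x, g)) => //; [exact: sup..| |].
    by move=> u neu; rewrite same ?out.
  apply: (R_local (f := f) (f' := f')); [exact: inn| |by apply: hR; rewrite mem_head].
  by move=> u eu; rewrite -inn // /z1 eu.
have [a ha] := decodeP h vf' (eq_leq se).
apply: (col' (x, a)) => //.
- by move=> u /sz /andP[].
- by move=> u /sf' /andP[].
- move=> u nu; rewrite /z1 /zs2 /=; case: ifPn => eu.
    rewrite ha //; case: ifP => // nsz; case E: (f' u) => //.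
    by have := sf' u; rewrite E /= /cdom eu nsz => /(_ isT).
  by rewrite hf //= negb_or eu.
- move=> u nu; rewrite /zs2 /=; case: ifPn => eu.
    rewrite ha //; case: ifP => // nsz; case E: (f' u) => //.
    by have := sf' u; rewrite E /= /cdom eu nsz => /(_ isT).
  by rewrite hf' //= negb_or eu.
move=> e' e'in; apply: (R_local (f := f) (f' := f')) => //; last first.
  by apply: hR; rewrite inE e'in orbT.
move=> u e'u; rewrite /z1; case: ifPn => // /sep /hasPn /(_ _ e'in).
by rewrite e'u.
Qed.

End Theorems.
End Cones.

(** * Adding one tree node *)

Section OneLevel.
Variables (b : nat) (C : finType).
Notation T := (seq 'I_b.+1).
Notation conf := (conf b).
Implicit Types (u v w e s t : T) (es : seq T) (f g : conf) (D P Q : pred T)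
  (tau : T -> T) (G : T -> option T) (c : conf -> C) (y : 'I_b.+1 -> T).

Definition node_tau e t y v : T :=
  if prefix e v then
    if drop (size e) v is i :: r then e ++ y i ++ r else e ++ t
  else v.

Definition node_G e N y G u : option T :=
  if prefix e u then
    let v := drop (size e) u in
    if size v < N then G v
    else if [pick i | y i == take N v] is Some i then Some (e ++ i :: drop N v) else None
  else Some u.

(* A single new tree node at [e ++ t], with exits [e ++ y i] at relative level N;
   [G] assigns the other nodes below level N to it or to nodes strictly below [e]. *)
Record gadget e N t y G : Prop := Gadget {
  gadget_size : forall i, size (y i) = N;
  gadget_step : forall i, prefix (rcons t i) (y i);
  gadget_self : G t = Some e;
  gadget_val : forall v s, size v < N -> G v = Some s ->
    (s = e /\ prefix t v) \/ (prefix s e /\ s <> e) }.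

Section Gadget.
Variables (e : T) (N : nat) (t : T) (y : 'I_b.+1 -> T) (G : T -> option T).
Hypothesis gad : gadget e N t y G.

Lemma node_tau_root : node_tau e t y e = e ++ t.
Proof. by rewrite /node_tau prefix_refl drop_size. Qed.

Lemma node_tau_cons i r : node_tau e t y (e ++ i :: r) = e ++ y i ++ r.
Proof. by rewrite /node_tau prefix_prefix drop_size_cat. Qed.

Lemma node_tau_out v : ~~ prefix e v -> node_tau e t y v = v.
Proof. by rewrite /node_tau => /negPf->. Qed.

Lemma node_tau_below s : prefix s e -> s <> e -> node_tau e t y s = s.
Proof.
by move=> se ne; apply: node_tau_out; apply/negP=> /(prefix_anti se).
Qed.

Lemma gadget_lt : size t < N.
Proof.
by have := size_prefix (gadget_step gad ord0); rewrite size_rcons (gadget_size gad).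
Qed.

Lemma gadget_inj : injective y.
Proof.
move=> i j E; have h := gadget_step gad i; rewrite E in h.
exact: prefix_rcons_inj h (gadget_step gad j).
Qed.

Lemma node_G_block w : size w < N -> node_G e N y G (e ++ w) = G w.
Proof. by move=> h; rewrite /node_G prefix_prefix drop_size_cat //= h. Qed.

Lemma node_G_exit i r : node_G e N y G (e ++ y i ++ r) = Some (e ++ i :: r).
Proof.
have sy := gadget_size gad i.
rewrite /node_G prefix_prefix drop_size_cat //= size_cat sy ltnNge leq_addr /=.
rewrite -sy take_size_cat // drop_size_cat //.
by case: pickP => [j /eqP/gadget_inj->|/(_ i)] //; rewrite eqxx.
Qed.

Lemma node_G_out u : ~~ prefix e u -> node_G e N y G u = Some u.
Proof. by rewrite /node_G => /negPf->. Qed.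

Lemma node_space h :
  space (cdom e h.+1) (cdom e (N + h)) (node_tau e t y) (guard (cdom e h.+1) (node_G e N y G)).
Proof.
apply: guard_space.
- exact: cdom_down.
- move=> v i _; have [/prefixP[[|j r] ->]|nev] := boolP (prefix e v).
  + rewrite cats0 node_tau_root -(cats1 e) node_tau_cons cats0 rcons_cat prefix_cat2.
    exact: (gadget_step gad).
  + by rewrite (rcons_cat i e (j :: r)) !node_tau_cons !rcons_cat prefix_refl.
  rewrite (node_tau_out nev); have [|nev'] := boolP (prefix e (rcons v i)).
    rewrite prefix_rconsE (negPf nev) orbF => /eqP<-.
    by rewrite node_tau_root prefix_prefix.
  by rewrite (node_tau_out nev') prefix_refl.
- move=> u v; have [/prefixP[w ->]|neu] := boolP (prefix e u); last first.
    by rewrite node_G_out // => -[<-] _; rewrite node_tau_out // prefix_refl /cdom neu.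
  have [lt|ge] := ltnP (size w) N.
    rewrite node_G_block // => /(gadget_val gad lt) hv _; split.
      by rewrite /cdom prefix_prefix /= size_cat ltn_add2l ltn_addr.
    case: hv => [[-> tw]|[ve ne]]; first by rewrite node_tau_root prefix_cat2.
    by rewrite node_tau_below // prefix_catl.
  rewrite /node_G prefix_prefix drop_size_cat //= ltnNge ge /=.
  case: pickP => // i /eqP E [<-]; rewrite /cdom !prefix_prefix /= !size_cat /= size_drop.
  rewrite !ltn_add2l ltnS => lt; split; first by rewrite -ltn_subLR.
  by rewrite node_tau_cons E cat_take_drop prefix_refl.
- move=> v; have [/prefixP[[|i r] ->] _|nev _] := boolP (prefix e v).
  + by rewrite cats0 node_tau_root node_G_block ?gadget_lt // (gadget_self gad).
  + by rewrite node_tau_cons node_G_exit.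
  by rewrite node_tau_out // node_G_out.
Qed.

Variable h : nat.
Let tau1 := node_tau e t y.
Let G1 := guard (cdom e h.+1) (node_G e N y G).

Lemma node_ident : ident (prefix e) tau1 G1.
Proof.
by move=> u neu; rewrite /tau1 node_tau_out // /G1 /guard node_G_out // /cdom neu.
Qed.

Lemma node_act_out g u : valid g -> ~~ prefix e u -> act tau1 G1 g u = g u.
Proof.
by move=> vg; apply: (act_ident node_ident) => // v w h1 h2; apply: prefix_trans h1.
Qed.

Lemma node_act_block g w : size w < N ->
  act tau1 G1 g (e ++ w) = if G w is Some v then omap tau1 (g v) else None.
Proof.
move=> sw; rewrite /act /G1 /guard node_G_block //.
case E: (G w) => [v|] //.
have -> // : cdom e h.+1 v; case: (gadget_val gad sw E) => [[-> _]|[ve ne]].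
  by rewrite /cdom prefix_refl /= addnS ltnS leq_addr.
by rewrite /cdom; case ev: (prefix e v) => //; case: ne; apply: prefix_anti.
Qed.

Lemma node_act_exit g i r : supp (cdom e h.+1) g ->
  act tau1 G1 g (e ++ y i ++ r) = omap tau1 (g (e ++ i :: r)).
Proof.
move=> sg; rewrite /act /G1 /guard node_G_exit; case: ifPn => // nD.
by case E: (g _) => //; have := sg (e ++ i :: r); rewrite E (negPf nD) => /(_ isT).
Qed.

Lemma node_act_top g s : valid g -> act tau1 G1 g s = Some s -> prefix e s ->
  (s = e ++ t /\ g e = Some e) \/
  exists i r, s = e ++ y i ++ r /\ g (e ++ i :: r) = Some (e ++ i :: r).
Proof.
move=> vg /(act_top (node_space h) vg)[s' [_ -> gs']] es.
have [/prefixP[[|i r] Es]|nes'] := boolP (prefix e s').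
- by left; move: gs'; rewrite Es cats0 node_tau_root.
- by right; exists i, r; rewrite -Es -{1}(node_tau_cons i r) -Es.
by move: es; rewrite node_tau_out // (negPf nes').
Qed.

End Gadget.

Variables (R : T -> nat -> conf -> conf -> Prop) (Good : (conf -> C) -> Prop).

(** The forest is that of all words of length [N1] above [e], since the exits are not known yet; the
    block below them enters as a parameter. Afterwards any gadget, chosen with knowledge of the
    simplified colouring, may be composed with the result. *)
Lemma one_level h : forest_theorem R Good h -> forall (l N1 : nat) (X : finType),
  exists N lab, lab_mono lab /\ forall e, size e = l ->
  forall (zs : X -> conf) c, Good c -> exists tau' G',
  [/\ space (cdom e (N1 + h)) (cdom e N) tau' G',
      ident (fun u => prefix e u && (l + N1 <= size u)) tau' G',
      forall x f f', valid f -> valid f' ->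
        supp (cdom e (N1 + h)) f -> supp (cdom e (N1 + h)) f' ->
        agree_out (prefix e) f (zs x) -> agree_out (prefix e) f' (zs x) ->
        (forall u, prefix e u -> size u < l + N1 -> f u = f' u) ->
        (forall w, size w = N1 -> R (e ++ w) h f f') ->
        c (act tau' G' f) = c (act tau' G' f')
    & forall t y G, gadget e N1 t y G ->
      let tau1 := node_tau e t y in
      let G1 := guard (cdom e h.+1) (node_G e N1 y G) in
      [/\ space (cdom e h.+1) (cdom e N) (tau' \o tau1) (fun u => obind G1 (G' u)),
          ident (prefix e) (tau' \o tau1) (fun u => obind G1 (G' u)),
          keeps [:: e] (cdom e h.+1) (tau' \o tau1)
        & forall v, size v < h.+1 -> lab (drop l (tau' (tau1 (e ++ v)))) = size v]].
Proof.
move=> forest l N1 X.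
pose ws := [seq tval x | x <- enum {: N1.-tuple 'I_b.+1}].
have wsP w : (w \in ws) = (size w == N1).
  apply/mapP/eqP=> [[x _ ->]|sw]; first by rewrite size_tuple.
  by move/eqP: sw => sw; exists (Tuple sw); rewrite ?mem_enum.
have [N' [labs [mono HF]]] := forest (nseq (size ws) (l + N1)) (X * code b l N1)%type.
(* The block contains a single tree node, the new one, of grade 0; beyond the block the grade of the
   relevant cone is raised by one. *)
pose lab v := if size v < N1 then 0 else (labs (index (take N1 v) ws) (drop N1 v)).+1.
exists (N1 + N'), lab; split.
  move=> u v uv; rewrite /lab; case: ltnP => // Nu.
  have Nv : N1 <= size v := leq_trans Nu (size_prefix uv); rewrite [size v < N1]ltnNge Nv /=.
  case/prefixP: uv => w ->; rewrite takel_cat // ltnS drop_cat.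
  rewrite ltn_neqAle Nu andbT; case: eqP => [->|_] /=; last exact: mono (prefix_prefix _ _).
  by rewrite drop_size; apply: mono; rewrite prefix0s.
move=> e se zs c Gc.
pose es := [seq e ++ w | w <- ws].
have esP e' : reflect (exists2 w, size w = N1 & e' = e ++ w) (e' \in es).
  apply: (iffP mapP) => -[w hw ->]; exists w => //; first by apply/eqP; rewrite -wsP.
  by rewrite wsP hw.
have ses : map size es = nseq (size ws) (l + N1).
  suff /all_pred1P-> : all (pred1 (l + N1)) (map size es) by rewrite !size_map.
  by apply/allP=> _ /mapP[_ /esP[w sw ->] ->]; rewrite /= size_cat sw se.
have ues : uniq es.
  rewrite map_inj_uniq => [|w w' /eqP]; last by rewrite eqseq_cat // eqxx => /eqP.
  by rewrite map_inj_uniq ?enum_uniq //; apply: val_inj.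
have inc : incomparable es.
  have sz e' : e' \in es -> size e' = l + N1.
    by case/esP=> w sw ->; rewrite size_cat sw se.
  elim: (es) sz ues => //= x es' IHx sz /andP[nx ues']; apply/andP; split; last first.
    by apply: IHx => // e' h'; apply: sz; rewrite inE h' orbT.
  apply/allP=> e' e'in; have h1 := sz x (mem_head _ _).
  have h2 := sz e'; rewrite inE e'in orbT in h2; have {}h2 := h2 isT.
  by apply/andP; split; apply/negP=> /prefix_size_eq; rewrite h1 h2 => /(_ (leqnn _)) E;
     rewrite -E e'in in nx || rewrite E e'in in nx.
have covE u : covered es u = prefix e u && (l + N1 <= size u).
  apply/hasP/andP=> [[e' /esP[w sw ->] hu]|[/prefixP[w ->]]].
    split; first exact: catl_prefix hu.
    by have := size_prefix hu; rewrite size_cat sw se.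
  rewrite size_cat se leq_add2l => hw; exists (e ++ take N1 w).
    by apply/esP; exists (take N1 w) => //; rewrite size_takel.
  by rewrite prefix_cat2 prefix_take.
have fdomE k : fdom es k = cdom e (N1 + k).
  apply: functional_extensionality => u; apply/allP/idP => [hu|hu e' /esP[w sw ->]].
    rewrite /cdom; case eu: (prefix e u) => //=; rewrite ltnNge; apply/negP=> hk.
    have: covered es u by rewrite covE eu -se; lia.
    case/hasP=> e' e'in e'u; have := hu _ e'in; rewrite /cdom e'u /=.
    case/esP: e'in => w sw ->; rewrite size_cat sw; lia.
  rewrite /cdom; case ewu: (prefix _ u) => //=.
  by move: hu; rewrite /cdom (catl_prefix ewu) /= size_cat sw addnA.
pose zs1 (p : X * code b l N1) u := if prefix e u then decode e p.2 u else zs p.1 u.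
have [tau' [G' [sp' id' keep' hlab' col']]] := HF es ses inc zs1 c Gc.
rewrite !fdomE in sp' keep' col'; have covF : covered es = fun u => prefix e u && (l + N1 <= size u).
  exact: functional_extensionality.
rewrite covF in id' col'.
exists tau', G'; split=> //.
  move=> x f f' vf vf' sf sf' hf hf' hin hR.
  have [a ha] := decodeP N1 vf (eq_leq se).
  apply: (col' (x, a)) => // [u|u|e' /esP[w sw ->]]; last exact: hR.
    rewrite negb_and -ltnNge /zs1 /=; case: ifPn => eu /= hu; last exact: hf.
    by rewrite ha // se hu.
  rewrite negb_and -ltnNge /zs1 /=; case: ifPn => eu /= hu; last exact: hf'.
  by rewrite ha // se hu hin.
move=> t y G gad tau1 G1; have sp1 : space _ _ tau1 G1 := node_space gad h.
split; first exact: comp_space sp1 sp'.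
- move=> u neu; rewrite /= /tau1 node_tau_out //.
  have nu : ~~ (prefix e u && (l + N1 <= size u)) by rewrite (negPf neu).
  by rewrite (id' _ nu).1 (id' _ nu).2 /= /G1 /guard node_G_out // /cdom neu.
- move=> e' v; rewrite inE => /eqP-> Dv ev /=.
  have etv : prefix e (tau1 v).
    case/prefixP: ev => -[|i r] ->; rewrite /tau1.
      by rewrite cats0 node_tau_root prefix_prefix.
    by rewrite node_tau_cons prefix_prefix.
  have [cov|ncov] := boolP (prefix e (tau1 v) && (l + N1 <= size (tau1 v))); last first.
    by rewrite (id' _ ncov).1.
  move: cov; rewrite -covE => /hasP[_ /esP[w sw ->] hw].
  apply: (catl_prefix (s3 := w)); apply: keep' hw; last exact: (space_raw sp1).
  by apply/esP; exists w.
case=> [|i r] hv.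
  rewrite cats0 /tau1 node_tau_root (id' _ _).1; last first.
    by rewrite size_cat se leq_add2l leqNgt (gadget_lt gad) andbF.
  by rewrite -se drop_size_cat // /lab (gadget_lt gad).
rewrite /tau1 node_tau_cons catA.
have yin : y i \in ws by rewrite wsP (gadget_size gad).
have kin : index (y i) ws < size es by rewrite size_map index_mem.
have nk : nth [::] es (index (y i) ws) = e ++ y i.
  by rewrite (nth_map [::]) ?index_mem // nth_index.
have Dr : cdom e (N1 + h) ((e ++ y i) ++ r).
  by rewrite /cdom !size_cat (gadget_size gad); apply/orP; right; move: hv => /=; lia.
have /prefixP[z Ez] : prefix (e ++ y i) (tau' ((e ++ y i) ++ r)).
  by apply: keep' => //; [apply/esP; exists (y i) => //; apply: (gadget_size gad)|apply: prefix_prefix].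
have := hlab' _ r kin hv; rewrite nk Ez drop_size_cat // -catA -se drop_size_cat // /lab.
rewrite size_cat (gadget_size gad) ltnNge leq_addr /=.
by rewrite -(gadget_size gad i) take_size_cat // drop_size_cat // => ->.
Qed.

End OneLevel.

(** * Irrelevance of nodes off the tree *)

Section OffPath.
Variables (b : nat) (C : finType).
Notation T := (seq 'I_b.+1).
Notation conf := (conf b).
Implicit Types (u v w e s t : T) (es : seq T) (f g : conf) (D P Q : pred T)
  (tau : T -> T) (G : T -> option T) (c : conf -> C) (y : 'I_b.+1 -> T).

(** A cone of height 0 has no content, so the two configurations coincide. *)
Lemma cone_theorem0 R (Good : (conf -> C) -> Prop) : cone_theorem R Good 0.
Proof.
move=> l X; exists 0, (fun=> 0); split=> // e se zs c _.
exists id, (guard (cdom e 0) Some); split=> //.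
- apply: guard_space => //; first exact: cdom_down.
    by move=> v i _; apply: prefix_refl.
  by move=> u v [->] Dv; rewrite prefix_refl.
- by move=> u neu; rewrite /guard /cdom neu.
move=> x f f' _ _ sf sf' hf hf' _; congr (c (act _ _ _)).
apply: functional_extensionality => u; have [eu|neu] := boolP (prefix e u).
  have nD : ~~ cdom e 0 u by rewrite /cdom eu addn0 -leqNgt size_prefix.
  have none (g : conf) : supp (cdom e 0) g -> g u = None.
    by move=> sg; case E: (g u) => //; have := sg u; rewrite E (negPf nD) => /(_ isT).
  by rewrite !none.
by rewrite hf ?hf'.
Qed.

Definition off_path_in e (h : nat) f g : Prop :=
  forall u, prefix e u -> f u = g u \/ (clear f u /\ clear g u).

Lemma off_path_local e h f f' g g' : agree_in (prefix e) f g ->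
  agree_in (prefix e) f' g' -> off_path_in e h f f' -> off_path_in e h g g'.
Proof.
move=> hg hg' H u eu; rewrite -hg // -hg' //.
case: (H u eu) => [->|[cf cf']]; [by left|right].
by split=> s us; have es := prefix_trans eu us; [rewrite -hg|rewrite -hg'] => //; auto.
Qed.

Lemma valid_below e f s : valid f -> f e = Some s -> s <> e ->
  exists2 j : 'I_(size e), take j e = s & f (take j e) = Some s.
Proof.
move=> vf E ne; have [se fs] := vf _ _ E.
have lt : size s < size e.
  by rewrite ltnNge; apply/negP=> /(prefix_size_eq se).
by exists (Ordinal lt); move: (se); rewrite prefixE => /eqP /= ->.
Qed.

Lemma nseq_prefix (x : 'I_b.+1) p q : p <= q -> prefix (nseq p x) (nseq q x).
Proof. by move=> /subnKC <-; rewrite nseqD prefix_prefix. Qed.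

Lemma first_variable (A : eqType) (ln : seq (option A)) q :
  nth None ln q = None -> q < size ln -> index None ln <= q.
Proof.
move=> E lt; rewrite leqNgt; apply/negP=> /(before_find None).
by rewrite /= E eqxx.
Qed.

(** On the path of zeros, a letter [Some j] joins the node to the member of the ancestor of [e] at
    depth [j], the letter [None] leaves it in no member, and a variable joins it to the member of
    [e]. *)
Definition off_gadget e (ln : seq (option (option 'I_(size e)))) v : option T :=
  if v == nseq (size v) ord0 then
    match nth None ln (size v) with
    | None => Some e
    | Some j => omap (fun j : 'I_(size e) => take j e) j
    end
  else None.

(** The tree node is put at the first variable, so that every other node with label [e] lies above
    it. *)
Lemma off_gadgetP e N (ln : seq (option (option 'I_(size e)))) :
  size ln = N -> None \in ln ->
  gadget e N (nseq (index None ln) ord0)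
    (fun i => nseq (index None ln) ord0 ++ i :: nseq (N - (index None ln).+1) ord0)
    (off_gadget ln).
Proof.
move=> sl nl; have lt : index None ln < N by rewrite -sl index_mem.
split.
- by move=> i; rewrite size_cat /= !size_nseq addnS -addSn subnKC.
- by move=> i; rewrite -cat_rcons prefix_prefix.
- by rewrite /off_gadget size_nseq eqxx nth_index.
move=> v s sv; rewrite /off_gadget; case: eqP => // -> ; rewrite size_nseq.
case E: (nth None ln (size v)) => [[j|]|] //= [<-].
  right; rewrite prefix_take; split=> // /(congr1 size).
  by rewrite size_takel 1?ltnW // => E'; have := ltn_ord j; rewrite E' ltnn.
by left; split=> //; apply: nseq_prefix; apply: first_variable; rewrite // sl.
Qed.

Definition off_word (X : Type) (zs : X -> conf) e N x (w : seq (option 'I_(size e))) : conf :=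
  fun u => if prefix e u then
    let v := drop (size e) u in
    if (size v < N) && (v == nseq (size v) ord0) then
      obind (fun j : 'I_(size e) => zs x (take j e)) (nth None w (size v))
    else None
  else zs x u.

(* The new tree node and its companions lie on the path [0, 00, 000, ..].  If the cone contains
   no minimum, the exits may be emptied by induction, so that the colour becomes a function of
   the word of labels read along that path. *)
Lemma off_path_step h : cone_theorem (C := C) off_path_in (fun=> True) h ->
  cone_theorem (C := C) off_path_in (fun=> True) h.+1.
Proof.
move=> /(cone_to_forest off_path_local (fun _ _ _ _ _ _ _ => I)) forest l X.
(* Colours are functions of [x], so that one line serves all outer configurations. *)
have [N1 HN1] := hales_jewett (option 'I_l) {ffun X -> C}.
have [N [lab [mono one]]] := one_level forest l N1 X.
exists N, lab; split=> // e se zs c _; subst l.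
have [tau' [G' [sp' id' col' comp]]] := one e erefl zs c I.
have [ln [sl nl hl]] := HN1 (fun wd => [ffun x => c (act tau' G' (off_word zs N1 x wd))]).
have gad := off_gadgetP sl nl; have sp1 := node_space gad h.
have [spc idc kc labc] := comp _ _ _ gad.
eexists; eexists; split; [exact: spc|exact: idc|exact: kc|exact: labc|].
move=> x f f' vf vf' sf sf' hf hf' hR; rewrite !act_comp.
set tau1 := node_tau _ _ _ in sp1 *; set G1 := guard _ _ in sp1 *.
have out g u : valid g -> ~~ prefix e u -> act tau1 G1 g u = g u.
  exact: node_act_out.
have block g w : size w < N1 -> act tau1 G1 g (e ++ w) =
    if off_gadget ln w is Some v then omap tau1 (g v) else None.
  exact: (node_act_block gad).
have tops s : prefix e s -> f s = Some s <-> f' s = Some s.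
  move=> es; case: (hR s es) => [->//|[cf cf']].
  by split=> [/cf|/cf'] []; apply: prefix_refl.
have offp : off_path f f'.
  move=> u; have [/hR//|neu] := boolP (prefix e u).
  by left; rewrite hf ?hf'.
(* A minimum in the cone puts [e] on a branch, hence [f e = f' e]: the block does not change, and
   what varies above the exits is covered by [col']. *)
have [[s0 [es0 fs0]]|none] := classic (exists s, prefix e s /\ f s = Some s).
  have fe : f e = f' e.
    by case: (hR e (prefix_refl e)) => // -[] /(_ _ es0 fs0).
  apply: (col' x).
  - exact: (act_valid sp1 vf).
  - exact: (act_valid sp1 vf').
  - exact: (act_supp sp1).
  - exact: (act_supp sp1).
  - by move=> u neu; rewrite out ?hf.
  - by move=> u neu; rewrite out ?hf'.
  - move=> u /prefixP[w ->]; rewrite size_cat ltn_add2l => sw; rewrite !block //.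
    case E: (off_gadget ln w) => [v|] //.
    case: (gadget_val gad sw E) => [[-> _]|[ve ne]]; first by rewrite fe.
    rewrite hf ?hf' //; apply/negP=> ev; exact/ne/prefix_anti.
  move=> w sw u _; exact: (act_off_path sp1 vf vf' offp u).
have canon (g : conf) : valid g -> agree_out (prefix e) g (zs x) ->
    (forall s, prefix e s -> g s <> Some s) ->
    exists a, c (act tau' G' (act tau1 G1 g)) =
              c (act tau' G' (off_word zs N1 x (fill a ln))).
  move=> vg hg no.
  have labels v s : prefix v e -> g v = Some s -> tau1 s = s /\ ~~ prefix e s.
    move=> ve E; have [sv gs] := vg _ _ E; have se := prefix_trans sv ve.
    have ne : ~~ prefix e s by apply/negP=> /no.
    by rewrite /tau1 node_tau_out.
  (* As [e] is not a minimum here, its label is also carried by a proper prefix of [e] and so is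
     expressed by a letter. *)
  have [a ha] : exists a : option 'I_(size e), g e = obind (fun j : 'I__ => g (take j e)) a.
    case E: (g e) => [s|]; last by exists None.
    have [|j _ gj] := valid_below vg E; last by exists (Some j).
    by move=> se; apply: (no e) => //; rewrite ?prefix_refl // E se.
  exists a; have zsg j : j < size e -> zs x (take j e) = g (take j e).
    move=> lt; rewrite hg //; apply/negP=> /size_prefix; rewrite (size_takel (ltnW lt)).
    by rewrite leqNgt lt.
  have wlab u s : prefix e u -> off_word zs N1 x (fill a ln) u = Some s ->
      [/\ prefix s e, ~~ prefix e s & g s = Some s].
    rewrite /off_word => ->; case: ifP => // _.
    case: (nth _ _ _) => //= j; rewrite zsg // => E; have [sj gs] := vg _ _ E.
    split=> //; first by apply: prefix_trans sj (prefix_take _ _).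
    by apply/negP=> /no.
  (* No minimum lies above level [N1] on either side, so [col'] allows the contents there to be
     erased. *)
  apply: (col' x).
  - exact: (act_valid sp1 vg).
  - move=> u s; case eu: (prefix e u) => E.
      have [se ne gs] := wlab _ _ eu E; split; first exact: prefix_trans eu.
      by rewrite /off_word (negPf ne) -hg.
    move: E; rewrite /off_word eu -hg ?eu // => E; have [su gs] := vg _ _ E.
    have ne : prefix e s = false.
      by apply/negP=> h1; move/negP: eu; apply; apply: prefix_trans su.
    by rewrite ne -hg ?ne.
  - exact: (act_supp sp1).
  - move=> u; rewrite /cdom /off_word; case eu: (prefix e u) => //=.
    by case: ifP => // /andP[lt _] _; move: lt; rewrite size_drop; lia.
  - by move=> u neu; rewrite out ?hg.
  - by move=> u neu; rewrite /off_word (negPf neu).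
  - move=> u /prefixP[w ->]; rewrite size_cat ltn_add2l => sw; rewrite block //.
    rewrite /off_word prefix_prefix drop_size_cat // sw /= /off_gadget.
    case: eqP => // _; rewrite (nth_map None) ?sl //.
    case E: (nth None ln (size w)) => [[j|]|] //=.
      rewrite zsg //; case E': (g _) => [s|] //=.
      by rewrite (labels _ _ (prefix_take _ _) E').1.
    rewrite ha; case: (a) => //= j; rewrite zsg //; case E': (g _) => [s|] //=.
    by rewrite (labels _ _ (prefix_take _ _) E').1.
  move=> w sw u eu; right; have {}eu := catl_prefix eu; split=> s us.
    move=> /(act_top sp1 vg)[s' [_ Es gs']]; apply: (no s) => //.
      exact: prefix_trans us.
    have nes' : ~~ prefix e s' by apply/negP=> /no.
    by rewrite Es /tau1 node_tau_out.
  have es := prefix_trans eu us.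
  by move=> /(wlab _ _ es)[_ /negP].
have [a ->] : exists a, c (act tau' G' (act tau1 G1 f)) =
    c (act tau' G' (off_word zs N1 x (fill a ln))).
  by apply: canon => // s es fs; apply: none; exists s.
have [a' ->] : exists a, c (act tau' G' (act tau1 G1 f')) =
    c (act tau' G' (off_word zs N1 x (fill a ln))).
  by apply: canon => // s es /tops fs; apply: none; exists s; split=> //; apply: fs.
by have /ffunP/(_ x) := hl a a'; rewrite !ffunE.
Qed.

Lemma off_path_theorem h : cone_theorem (C := C) off_path_in (fun=> True) h.
Proof. by elim: h => [|h]; [apply: cone_theorem0|apply: off_path_step]. Qed.

End OffPath.

(** * Irrelevance of directions *)

Section Similarity.
Variables (b : nat) (C : finType).
Notation T := (seq 'I_b.+1).
Notation conf := (conf b).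
Implicit Types (u v w e s t r : T) (es : seq T) (f g : conf) (D P Q : pred T)
  (tau : T -> T) (G : T -> option T) (c : conf -> C) (y : 'I_b.+1 -> T) (A B : pred T).

(* Two sets of nodes of height below n are similar if each can be carried to the other by
   changing, at nodes outside the set, the direction in which the set continues. *)
Fixpoint sim (n : nat) A B : Prop :=
  if n is n'.+1 then
    [/\ A [::], B [::] & forall i, sim n' (fun r => A (i :: r)) (fun r => B (i :: r))] \/
    [/\ ~~ A [::], ~~ B [::] & exists i i',
      [/\ forall j r, j <> i -> ~~ A (j :: r), forall j r, j <> i' -> ~~ B (j :: r)
        & sim n' (fun r => A (i :: r)) (fun r => B (i' :: r))]]
  else True.

Lemma sim_none n A B : (forall r, ~~ A r) -> (forall r, ~~ B r) -> sim n A B.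
Proof.
elim: n A B => //= n IH A B hA hB; right; split=> //; exists ord0, ord0.
by split=> //; apply: IH => r.
Qed.

Definition tops f e : pred T := fun r => f (e ++ r) == Some (e ++ r).

Definition sim_in e h f g : Prop := sim h (tops f e) (tops g e).

Definition off_path_invariant c : Prop :=
  forall f g, valid f -> valid g -> off_path f g -> c f = c g.

Lemma tops_local e f g : agree_in (prefix e) f g -> tops f e = tops g e.
Proof.
by move=> h; apply: functional_extensionality => r; rewrite /tops h ?prefix_prefix.
Qed.

Lemma sim_local e h f f' g g' : agree_in (prefix e) f g ->
  agree_in (prefix e) f' g' -> sim_in e h f f' -> sim_in e h g g'.
Proof. by rewrite /sim_in => /tops_local-> /tops_local->. Qed.

Lemma off_path_invariant_act c D D' tau G : space D D' tau G ->
  off_path_invariant c -> off_path_invariant (fun f => c (act tau G f)).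
Proof.
move=> sp inv f g vf vg h; apply: inv; [exact: (act_valid sp)..|].
exact: (act_off_path sp).
Qed.

(** * Gadgets whose words carry labels and directions *)

Section Gadgets.
Variables (e : T) (N h : nat).
Notation letter := (option 'I_(size e) * 'I_b.+1)%type.
Implicit Types (ln : seq (option letter)) (wd : seq letter).

Definition dir (i : 'I_b.+1) (o : option letter) : 'I_b.+1 := if o is Some q then q.2 else i.

Definition sim_exit ln i : T := map (dir i) ln.

Lemma fill_exit ln a i : map snd (fill (a, i) ln) = sim_exit ln i.
Proof. by rewrite /fill -map_comp; apply: eq_map => -[]. Qed.

Definition sim_gadget ln v : option T :=
  if [exists i, prefix v (sim_exit ln i)] then
    match nth None ln (size v) with
    | None => Some e
    | Some q => omap (fun j : 'I_(size e) => take j e) q.1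
    end
  else None.

Lemma sim_exit_take ln i j :
  take (index None ln) (sim_exit ln i) = take (index None ln) (sim_exit ln j).
Proof.
rewrite -!map_take; apply/eq_in_map => -[q|] //=.
by rewrite in_take_leq ?index_size // ltnn.
Qed.

(** All exits agree up to the first variable and separate there, which makes it the place of the
    tree node. Labels depend on the length only, so they are consistent on the common parts of the
    paths. *)
Lemma sim_gadgetP ln : size ln = N -> None \in ln ->
  gadget e N (take (index None ln) (sim_exit ln ord0)) (sim_exit ln) (sim_gadget ln).
Proof.
move=> sl nl; have lt : index None ln < N by rewrite -sl index_mem.
have st : size (take (index None ln) (sim_exit ln ord0)) = index None ln.
  by rewrite size_takel // size_map sl ltnW.
split.
- by move=> i; rewrite size_map.
- move=> i; rewrite (sim_exit_take ln ord0 i) /sim_exit -map_take.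
  have := nth_index None nl; move: lt; rewrite -{1}sl; set p := index None ln => lt E.
  have {2}-> : ln = take p ln ++ None :: drop p.+1 ln.
    by rewrite -{1}(cat_take_drop p ln) (drop_nth None lt) E.
  by rewrite map_cat /= -cat_rcons prefix_prefix.
- rewrite /sim_gadget st nth_index //; case: existsP => // -[]; exists ord0.
  exact: prefix_take.
move=> v s sv; rewrite /sim_gadget; case: existsP => // -[i vi].
case E: (nth None ln (size v)) => [[[j|] d]|] //= [<-].
  right; rewrite prefix_take; split=> // /(congr1 size).
  by rewrite size_takel 1?ltnW // => E'; have := ltn_ord j; rewrite E' ltnn.
left; split=> //; have le := first_variable E; rewrite sl in le.
move: vi; rewrite prefixE => /eqP <-; rewrite (sim_exit_take ln ord0 i).
by rewrite -(take_takel (sim_exit ln i) (le sv)) prefix_take.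
Qed.

(* Transports a label from the cone above the successor of [e] to the cone above [ex]. *)
Definition shift ex s : T := if size s < size e then s else ex ++ drop (size e).+1 s.

Notation content := {ffun h.-bseq 'I_b.+1 -> option ('I_(size e) + 'I_h.+1)}.

Definition read ex (a : content) r : option T :=
  if size r < h then
    obind (fun z : h.-bseq 'I_b.+1 => omap (fun q => match q with
        | inl j => take (nat_of_ord j) e
        | inr m => ex ++ take (nat_of_ord m) r
        end) (a z)) (insub r)
  else None.

(** As [e] is no minimum, a label is either a proper prefix of [e], stored by its length, or begins
    with [rcons e i], stored by its length beyond that. Neither mentions an exit, so the same
    content can be placed above any exit. *)
Lemma readP g i : valid g -> g e <> Some e ->
  exists a : content, forall ex r, size r < h ->
    read ex a r = omap (shift ex) (g (e ++ i :: r)).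
Proof.
move=> vg ge.
exists [ffun z : h.-bseq 'I_b.+1 => obind (fun s =>
  match insub (size s) with
  | Some j => Some (inl j)
  | None => omap inr (insub (size s - (size e).+1))
  end) (g (e ++ i :: z))].
move=> ex r hr; have hr' : size r <= h := ltnW hr.
rewrite /read hr insubT /= ffunE /=.
case E: (g _) => [s|] //=; have [sr gs] := vg _ _ E; rewrite /shift.
case: ltnP => hs.
  rewrite insubT /=; congr Some; apply/eqP; rewrite -prefixE.
  have := prefix_total sr (prefix_prefix e (i :: r)).
  by case/orP=> // /size_prefix; rewrite leqNgt hs.
rewrite insubF ?ltnNge ?hs //.
have es : prefix e s.
  have := prefix_total sr (prefix_prefix e (i :: r)).
  by case/orP=> // /prefix_size_eq /(_ hs) ->; apply: prefix_refl.
case/prefixP: es sr gs {hs E} => -[|j w] ->; first by rewrite cats0.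
rewrite prefix_cat2 /= => /andP[/eqP-> wr] _.
have sw : size w <= size r by apply: size_prefix.
have hw : size w < h.+1 by rewrite ltnS (leq_trans sw).
rewrite size_cat /= addnS subSS addKn insubT /=.
rewrite -cat_rcons drop_size_cat ?size_rcons //.
by move: wr; rewrite prefixE => /eqP->.
Qed.

Definition path_conf (X : Type) (zs : X -> conf) x (a : content) (wd : seq letter) : conf :=
  fun u => if prefix e u then
    let v := drop (size e) u in
    if size v < N then
      if prefix v (map snd wd) then
        obind (fun j : 'I_(size e) => zs x (take j e)) (nth None (map fst wd) (size v))
      else None
    else if take N v == map snd wd then read (e ++ map snd wd) a (drop N v) else None
  else zs x u.

(** * The configuration of one labelled path with a content above its end *)

Section PathConf.
Variables (X : Type) (zs : X -> conf) (x : X) (g : conf) (i : 'I_b.+1) (a : content)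
  (wd : seq letter).
Hypotheses (vg : valid g) (sg : supp (cdom e h.+1) g) (hg : agree_out (prefix e) g (zs x))
  (ge : g e <> Some e) (sw : size wd = N)
  (ha : forall ex r, size r < h -> read ex a r = omap (shift ex) (g (e ++ i :: r))).

Let pc := path_conf zs x a wd.
Let ex := e ++ map snd wd.

Lemma path_conf_out u : ~~ prefix e u -> pc u = g u.
Proof. by move=> neu; rewrite /pc /path_conf (negPf neu) hg. Qed.

Lemma content_none r : h <= size r -> g (e ++ i :: r) = None.
Proof.
move=> hr; case E: (g _) => //; have := sg (u := e ++ i :: r); rewrite E => /(_ isT).
by rewrite /cdom prefix_prefix size_cat /= ltn_add2l ltnS ltnNge hr.
Qed.

Lemma path_conf_exit r : pc (ex ++ r) = omap (shift ex) (g (e ++ i :: r)).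
Proof.
have sd : size (map snd wd) = N by rewrite size_map.
rewrite /pc /path_conf /ex -catA prefix_prefix drop_size_cat //= size_cat sd.
rewrite ltnNge leq_addr /= -sd take_size_cat // drop_size_cat // eqxx.
have [hr|hr] := ltnP (size r) h; first by rewrite ha.
by rewrite /read ltnNge hr content_none.
Qed.

Lemma zs_below j : j < size e -> zs x (take j e) = g (take j e).
Proof.
move=> lt; rewrite hg //; apply/negP=> /size_prefix; rewrite (size_takel (ltnW lt)).
by rewrite leqNgt lt.
Qed.

Lemma path_conf_block u s : prefix e u -> size u < size e + N -> pc u = Some s ->
  [/\ prefix s e, ~~ prefix e s & g s = Some s].
Proof.
case/prefixP=> w ->; rewrite size_cat ltn_add2l => lt.
rewrite /pc /path_conf prefix_prefix drop_size_cat // lt; case: ifP => // _.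
case: (nth _ _ _) => //= j; rewrite zs_below // => E; have [sj gs] := vg E.
split=> //; first by apply: prefix_trans sj (prefix_take _ _).
apply/negP=> /size_prefix; rewrite leqNgt; case/negP.
by apply: leq_ltn_trans (size_prefix sj) _; rewrite size_takel // ltnW.
Qed.

Lemma path_conf_cone u s : prefix e u -> size e + N <= size u -> pc u = Some s -> prefix ex u.
Proof.
case/prefixP=> w ->; rewrite size_cat leq_add2l => le.
rewrite /pc /path_conf prefix_prefix drop_size_cat //= ltnNge le /=; case: eqP => // E _.
by rewrite /ex prefix_cat2 -E prefix_take.
Qed.

Lemma shift_top r s : g (e ++ i :: r) = Some s -> shift ex s = ex ++ r -> s = e ++ i :: r.
Proof.
move=> /vg[sr gs]; rewrite /shift; case: ltnP => hs.
  by move=> E; move: hs; rewrite E /ex -catA size_cat ltnNge leq_addr.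
move/eqP; rewrite eqseq_cat // eqxx /= => /eqP E.
have es : prefix e s.
  have := prefix_total sr (prefix_prefix e (i :: r)).
  by case/orP=> // /prefix_size_eq /(_ hs) ->; apply: prefix_refl.
case/prefixP: es sr gs E => -[|j w] ->; first by rewrite cats0.
rewrite prefix_cat2 /= => /andP[/eqP-> _] _.
by rewrite -{1}cat_rcons drop_size_cat ?size_rcons // => ->.
Qed.

Lemma path_conf_tops : tops pc ex = (fun r => tops g e (i :: r)).
Proof.
apply: functional_extensionality => r; rewrite /tops path_conf_exit.
apply/eqP/eqP => [|E].
  by case E: (g _) => [s|] //= [] /(shift_top E) <-.
rewrite E /= /shift size_cat ltnNge leq_addr /=.
by rewrite -cat_rcons drop_size_cat ?size_rcons.
Qed.

Lemma path_conf_top s : pc s = Some s -> prefix e s -> prefix ex s.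
Proof.
move=> E es; have [lt|le] := ltnP (size s) (size e + N).
  by have [_ /negP] := path_conf_block es lt E.
exact: path_conf_cone E.
Qed.

Lemma path_conf_valid : valid pc.
Proof.
have out s : ~~ prefix e s -> g s = Some s -> pc s = Some s.
  by move=> nes gs; rewrite path_conf_out.
move=> u s E; have [eu|neu] := boolP (prefix e u); last first.
  move: (E); rewrite path_conf_out // => /vg[su gs]; split=> //; apply: out => //.
  by apply: contra neu => es; apply: prefix_trans su.
have [lt|le] := ltnP (size u) (size e + N).
  have [se ne gs] := path_conf_block eu lt E.
  by split; [apply: prefix_trans eu|apply: out].
case/prefixP: (path_conf_cone eu le E) => r Er; move: E; rewrite Er path_conf_exit.
case F: (g _) => [s'|] //= [Es]; have [sr gs] := vg F; move: Es; rewrite /shift.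
case: ltnP => hs; last first.
  have es : prefix e s'.
    have := prefix_total sr (prefix_prefix e (i :: r)).
    by case/orP=> // /prefix_size_eq /(_ hs) ->; apply: prefix_refl.
  case/prefixP: es sr gs {hs F} => -[|j w] ->; first by rewrite cats0.
  rewrite prefix_cat2 /= => /andP[/eqP-> wr] gs.
  rewrite -cat_rcons drop_size_cat ?size_rcons // => <-; split; first by rewrite prefix_cat2.
  apply/eqP; have := congr1 (fun A : pred T => A w) path_conf_tops.
  by rewrite /tops => ->; rewrite gs.
move=> <-; have h1 : prefix s' e.
  have := prefix_total sr (prefix_prefix e (i :: r)).
  by case/orP=> // /size_prefix; rewrite leqNgt hs.
split; first by apply: prefix_trans h1 _; rewrite /ex -catA prefix_prefix.
apply: out => //; apply/negP=> /size_prefix; rewrite leqNgt; case/negP.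
exact: hs.
Qed.

Lemma path_conf_supp : supp (cdom e (N + h)) pc.
Proof.
move=> u; rewrite /cdom; case eu: (prefix e u) => //= E.
have [lt|le] := ltnP (size u) (size e + N); first by rewrite addnA ltn_addr.
case F: (pc u) E => [s|] // _; case/prefixP: (path_conf_cone eu le F) => r Er.
move: F; rewrite Er path_conf_exit /ex -catA !size_cat size_map sw !ltn_add2l.
by case: ltnP => // /content_none ->.
Qed.

End PathConf.

End Gadgets.

(* Since the colour ignores the nodes off the branches, a configuration in which the minima of
   the cone all lie in one direction of a node outside the set of minima amounts to a single
   word of labels and directions, followed by the content above the exit that it spells. *)
Lemma sim_step h : cone_theorem sim_in off_path_invariant h ->
  cone_theorem sim_in off_path_invariant h.+1.
Proof.
move=> /(cone_to_forest sim_local off_path_invariant_act) forest l X.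
pose content := {ffun h.-bseq 'I_b.+1 -> option ('I_l + 'I_h.+1)}.
(* One line has to work for all outer configurations and all contents above the exit. *)
have [N1 HN1] := hales_jewett (option 'I_l * 'I_b.+1)%type {ffun (X * content) -> C}.
have [N [lab [mono one]]] := one_level forest l N1 X.
exists N, lab; split=> // e se zs c inv; subst l.
have [tau' [G' [sp' id' col' comp]]] := one e erefl zs c inv.
have [ln [sl nl hl]] := HN1 (fun wd => [ffun p : X * content =>
  c (act tau' G' (path_conf N1 zs p.1 p.2 wd))]).
have gad := sim_gadgetP sl nl; have sp1 := node_space gad h.
have [spc idc kc labc] := comp _ _ _ gad.
eexists; eexists; split; [exact: spc|exact: idc|exact: kc|exact: labc|].
move=> x f f' vf vf' sf sf' hf hf' hR; rewrite !act_comp.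
set y := sim_exit ln in gad sp1 *.
set tau1 := node_tau _ _ _ in sp1 *; set G1 := guard _ _ in sp1 *.
have out g u : valid g -> ~~ prefix e u -> act tau1 G1 g u = g u.
  exact: node_act_out.
have block g w : size w < N1 -> act tau1 G1 g (e ++ w) =
    if sim_gadget ln w is Some v then omap tau1 (g v) else None.
  exact: (node_act_block gad).
have exit g i r : supp (cdom e h.+1) g ->
    act tau1 G1 g (e ++ y i ++ r) = omap tau1 (g (e ++ i :: r)).
  exact: (node_act_exit gad).
have top g s : valid g -> act tau1 G1 g s = Some s -> prefix e s ->
    (s = e ++ take (index None ln) (y ord0) /\ g e = Some e) \/
    exists i r, s = e ++ y i ++ r /\ g (e ++ i :: r) = Some (e ++ i :: r).
  exact: (node_act_top gad).
have labels g v s : valid g -> prefix v e -> g e <> Some e -> g v = Some s ->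
    tau1 s = s.
  move=> vg ve ge E; have [sv gs] := vg _ _ E; have se := prefix_trans sv ve.
  by apply: node_tau_below => // Es; apply: ge; rewrite -Es.
have tops_exit g i : valid g -> supp (cdom e h.+1) g ->
    tops (act tau1 G1 g) (e ++ y i) = fun r => tops g e (i :: r).
  move=> vg sg; apply: functional_extensionality => r.
  rewrite /tops -catA exit //; apply/eqP/eqP => [|->]; last by rewrite /= /tau1 node_tau_cons.
  move=> E; have E' : act tau1 G1 g (e ++ y i ++ r) = Some (e ++ y i ++ r) by rewrite exit.
  have [[/eqP]|[j [r' [/eqP]]]] := top _ _ vg E' (prefix_prefix _ _).
    rewrite eqseq_cat // eqxx /= => /eqP Et.
    have := gadget_lt gad; rewrite -Et size_cat (gadget_size gad).
    by rewrite ltnNge leq_addr.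
  by rewrite !eqseq_cat ?(gadget_size gad) // eqxx /= => /andP[/eqP/(gadget_inj gad)-> /eqP->].
have no_tops g w : valid g -> size w = N1 -> (forall i, w <> y i) ->
    forall r, ~~ tops (act tau1 G1 g) (e ++ w) r.
  move=> vg sw ne r; apply/eqP => E.
  have ew : prefix e ((e ++ w) ++ r) by rewrite -catA prefix_prefix.
  have [[/eqP]|[j [r' [/eqP]]]] := top _ _ vg E ew.
    rewrite -catA eqseq_cat // eqxx /= => /eqP Et.
    by have := gadget_lt gad; rewrite -Et size_cat sw ltnNge leq_addr.
  by rewrite -catA !eqseq_cat ?(gadget_size gad) ?sw // eqxx /= => /andP[/eqP /ne].
case: hR => [[fe f'e hsim]|[fe f'e [i [i' [hi hi' hsim]]]]].
  move: fe f'e; rewrite /tops !cats0 => /eqP fe /eqP f'e.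
  apply: (col' x).
  - exact: (act_valid sp1 vf).
  - exact: (act_valid sp1 vf').
  - exact: (act_supp sp1).
  - exact: (act_supp sp1).
  - by move=> u neu; rewrite out ?hf.
  - by move=> u neu; rewrite out ?hf'.
  - move=> u /prefixP[w ->]; rewrite size_cat ltn_add2l => sw; rewrite !block //.
    case E: (sim_gadget ln w) => [v|] //.
    case: (gadget_val gad sw E) => [[-> _]|[ve ne]]; first by rewrite fe f'e.
    rewrite hf ?hf' //; apply/negP=> ev; exact/ne/prefix_anti.
  (* Above an exit similarity is that of the successors of [e]; above any other word there are no
     minima to compare. *)
  move=> w sw; have [[i wi]|no] := classic (exists i, w = y i).
    by rewrite /sim_in wi !tops_exit //; apply: hsim.
  have {}no i : w <> y i by move=> E; apply: no; exists i.
  by apply: sim_none; apply: no_tops.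
move: fe f'e; rewrite /tops !cats0 => /eqP fe /eqP f'e.
have canon (g : conf) j (a : content) : valid g -> supp (cdom e h.+1) g ->
    agree_out (prefix e) g (zs x) -> g e <> Some e ->
    (forall i r, i <> j -> ~~ tops g e (i :: r)) ->
    (forall ex r, size r < h -> read ex a r = omap (shift e ex) (g (e ++ j :: r))) ->
    exists lam, c (act tau' G' (act tau1 G1 g)) =
                c (act tau' G' (path_conf N1 zs x a (fill (lam, j) ln))).
  move=> vg sg hg ge hj ha.
  have [lam hlam] : exists lam : option 'I_(size e),
      g e = obind (fun j : 'I__ => g (take j e)) lam.
    case E: (g e) => [s|]; last by exists None.
    have [|j' _ gj] := valid_below vg E; last by exists (Some j').
    by move=> se; apply: ge; rewrite E se.
  exists lam; have sw : size (fill (lam, j) ln) = N1 by rewrite size_map.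
  have dirs : map snd (fill (lam, j) ln) = y j by apply: fill_exit.
  have vp := path_conf_valid vg sg hg ge sw ha.
  (* All minima of the cone lie above the exit [e ++ y j]. The nodes of the cone incomparable with
     it are clear on both sides, and the colour ignores them. *)
  apply: (off_path_invariant_act sp' inv) => //; first exact: (act_valid sp1).
  have clear1 u : prefix e u -> ~~ prefix u (e ++ y j) -> ~~ prefix (e ++ y j) u ->
      clear (act tau1 G1 g) u.
    move=> eu n1 n2 s us E; have [[_ //]|[i0 [r [Es gi]]]] := top _ _ vg E (prefix_trans eu us).
    have [Ei|/eqP ne] := eqVneq i0 j; last first.
      by have := hj i0 r ne; rewrite /tops gi eqxx.
    have : prefix (e ++ y j) s by rewrite Es Ei catA prefix_prefix.
    by move/(prefix_total us); rewrite (negPf n1) (negPf n2).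
  have clear2 u : prefix e u -> ~~ prefix u (e ++ y j) -> ~~ prefix (e ++ y j) u ->
      clear (path_conf N1 zs x a (fill (lam, j) ln)) u.
    move=> eu n1 n2 s us E; have := path_conf_top vg hg E (prefix_trans eu us).
    by rewrite dirs => /(prefix_total us); rewrite (negPf n1) (negPf n2).
  move=> u; have [eu|neu] := boolP (prefix e u); last first.
    by left; rewrite out // /path_conf (negPf neu) hg.
  have [un|n1] := boolP (prefix (e ++ y j) u).
    left; case/prefixP: un => r ->; rewrite -{2}dirs.
    rewrite (path_conf_exit zs x sg sw ha) -catA exit //.
    case E: (g _) => [s|] //=; have [sr gs] := vg _ _ E; congr Some; rewrite /shift.
    case: ltnP => hs.
      rewrite /tau1 node_tau_out //; apply/negP=> /size_prefix; rewrite leqNgt; case/negP.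
      exact: hs.
    have es : prefix e s.
      have := prefix_total sr (prefix_prefix e (j :: r)).
      by case/orP=> // /prefix_size_eq /(_ hs) ->; apply: prefix_refl.
    case/prefixP: es sr gs {hs E} => -[|j' w] ->; first by rewrite cats0.
    rewrite prefix_cat2 /= => /andP[/eqP-> _] _.
    by rewrite /tau1 node_tau_cons -cat_rcons drop_size_cat ?size_rcons // dirs catA.
  have [un|n2] := boolP (prefix u (e ++ y j)); last by right; split; [apply: clear1|apply: clear2].
  left; case/prefixP: eu un n1 => w ->; rewrite !prefix_cat2 => wy yw.
  have lt : size w < N1.
    rewrite ltnNge; apply: contra yw => le; have /prefix_size_eq -> := wy.
      exact: prefix_refl.
    by rewrite (gadget_size gad).
  rewrite block // /path_conf prefix_prefix drop_size_cat // lt dirs wy /sim_gadget.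
  case: existsP => [_|[]]; last by exists j.
  rewrite (nth_map (lam, j)) ?sw // (nth_map None) ?sl //.
  have zsg k : k < size e -> zs x (take k e) = g (take k e) by apply: zs_below.
  case E: (nth None ln (size w)) => [[[k|] d]|] //=.
    rewrite zsg //; case E': (g _) => [s|] //=.
    by rewrite (labels _ _ _ vg (prefix_take _ _) ge E').
  rewrite hlam; case: (lam) => //= k; rewrite zsg //; case E': (g _) => [s|] //=.
  by rewrite (labels _ _ _ vg (prefix_take _ _) ge E').
have [a ha] := readP h i vf fe; have [a' ha'] := readP h i' vf' f'e.
have [lam ->] := canon _ _ _ vf sf hf fe hi ha.
have [lam' ->] := canon _ _ _ vf' sf' hf' f'e hi' ha'.
(* Moving along the line changes label and direction with the content [a] fixed; exchanging [a] for
   [a'] above the common exit is left to [col']. *)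
have /ffunP/(_ (x, a)) := hl (lam, i) (lam', i'); rewrite !ffunE /= => ->.
have sw : size (fill (lam', i') ln) = N1 by rewrite size_map.
have dirs : map snd (fill (lam', i') ln) = y i' by apply: fill_exit.
apply: (col' x).
- exact: (path_conf_valid vf sf hf fe sw ha).
- exact: (path_conf_valid vf' sf' hf' f'e sw ha').
- exact: (path_conf_supp sf sw ha).
- exact: (path_conf_supp sf' sw ha').
- by move=> u neu; rewrite /path_conf (negPf neu).
- by move=> u neu; rewrite /path_conf (negPf neu).
- by move=> u /prefixP[w ->] lt; rewrite /path_conf prefix_prefix drop_size_cat //=;
     rewrite size_cat ltn_add2l in lt; rewrite lt.
move=> w sw'; rewrite /sim_in; have [->|ne] := eqVneq w (y i').
  have := path_conf_tops zs x vf sf fe sw ha; rewrite dirs => ->.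
  by have := path_conf_tops zs x vf' sf' f'e sw ha'; rewrite dirs => ->.
have none g (a0 : {ffun h.-bseq 'I_b.+1 -> option ('I_(size e) + 'I_h.+1)}) :
    valid g -> agree_out (prefix e) g (zs x) ->
    forall r, ~~ tops (path_conf N1 zs x a0 (fill (lam', i') ln)) (e ++ w) r.
  move=> vg hg r; apply/eqP=> E.
  have := path_conf_top vg hg E; rewrite -catA prefix_prefix dirs => /(_ isT).
  rewrite prefix_cat2 prefixE take_size_cat ?(gadget_size gad) // => /eqP E'.
  by rewrite E' eqxx in ne.
by apply: sim_none; [apply: none vf hf|apply: none vf' hf'].
Qed.

Lemma sim_theorem h : cone_theorem sim_in off_path_invariant h.
Proof. by elim: h => [|h]; [apply: cone_theorem0|apply: sim_step]. Qed.

End Similarity.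

(** * The Ramsey theorem for configurations *)

Section Core.
Variables (b : nat) (C : finType).
Notation T := (seq 'I_b.+1).
Notation conf := (conf b).
Implicit Types (u v w e t r : T) (f g : conf) (D P Q : pred T)
  (tau s : T -> T) (G : T -> option T) (c : conf -> C) (rho : T -> nat).

Definition lev (h : nat) : pred T := fun v => size v < h.

Lemma cdom_lev h : cdom [::] h = lev h.
Proof. by apply: functional_extensionality => v; rewrite /cdom prefix0s. Qed.

Lemma lev_down h : down_closed (lev h).
Proof. by move=> v w hw vw; apply: leq_ltn_trans (size_prefix vw) hw. Qed.

(** * Stretching the tree to prescribed lengths *)

(** Zeros fill up each node to its prescribed length before the next direction is taken. *)
Fixpoint emb_rec rho v : T :=
  nseq (rho [::]) ord0 ++
  if v is i :: r then i :: emb_rec (fun w => rho (i :: w) - (rho [::]).+1) r else [::].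

Definition increasing rho : Prop := forall v i, rho v < rho (rcons v i).

Lemma increasing_cons rho i : increasing rho -> forall v, rho [::] < rho (i :: v).
Proof.
move=> inc v; elim/last_ind: v => [|v j IH]; first exact: inc [::] i.
by apply: ltn_trans IH _; rewrite -rcons_cons; apply: inc.
Qed.

Lemma increasing_shift rho i : increasing rho ->
  increasing (fun w => rho (i :: w) - (rho [::]).+1).
Proof.
move=> inc v j; have h1 := increasing_cons i inc v; have := inc (i :: v) j.
by rewrite rcons_cons; lia.
Qed.

Lemma size_emb rho v : increasing rho -> size (emb_rec rho v) = rho v.
Proof.
elim: v rho => [|i v IH] rho inc /=; first by rewrite cats0 size_nseq.
have := increasing_cons i inc v.
by rewrite size_cat size_nseq /= IH; [lia|apply: increasing_shift].
Qed.

Lemma emb_step rho D : increasing rho -> stepwise D (emb_rec rho).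
Proof.
move=> inc v i _; elim: v rho inc => [|j v IH] rho inc /=.
  by rewrite cats0 -cats1 prefix_cat2 /= eqxx prefix0s.
by rewrite rcons_cat prefix_cat2 /= eqxx IH //; apply: increasing_shift.
Qed.

Lemma emb_space rho N M : increasing rho -> (forall v, size v < N -> rho v < M) ->
  exists G, space (lev N) (lev M) (emb_rec rho) G.
Proof.
move=> inc hM.
pose ok u (z : N.-bseq 'I_b.+1) := (size z < N) && (emb_rec rho z == u).
exists (fun u => omap val [pick z | ok u z]).
have pickE u v : omap val [pick z | ok u z] = Some v -> size v < N /\ emb_rec rho v = u.
  by case: pickP => [z /andP[sz /eqP zu] [<-]|].
split.
- exact: lev_down.
- exact: emb_step.
- move=> u v /pickE[sv <-] _; rewrite prefix_refl; split=> //.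
  by rewrite /lev size_emb // hM.
- move=> v Dv; have sv : size v <= N := ltnW Dv.
  case: pickP => [z /andP[sz /eqP zu] /=|/(_ (Bseq sv))]; last by rewrite /ok /= (Dv : size v < N) eqxx.
  congr Some; apply: (step_inj (@lev_down N) (emb_step inc)) => //.
by move=> u v /pickE[].
Qed.

Definition level_mono h tau : Prop :=
  forall v w, size v < size w -> size w < h -> size (tau v) < size (tau w).

(* Stretching the levels by grade first turns grades into lengths. *)
Lemma normalize R (Good : (conf -> C) -> Prop) h :
  (forall c D D' tau G, space D D' tau G -> Good c -> Good (fun f => c (act tau G f))) ->
  cone_theorem R Good h ->
  exists N, forall c, Good c -> exists tau G,
  [/\ space (lev h) (lev N) tau G, level_mono h tau
    & forall f f', valid f -> valid f' -> supp (lev h) f -> supp (lev h) f' ->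
      R [::] h f f' -> c (act tau G f) = c (act tau G f')].
Proof.
move=> Good_act /(_ 0 unit)[N [lab [mono cone]]].
(* [lab] does not depend on the colouring, so the stretching can precede the choice of [tau0]. Raw
   lengths are below [N], so the grade outweighs them; adding the length keeps [rho] strictly
   increasing. *)
pose rho v := lab v * N.+1 + size v.
have inc : increasing rho.
  move=> v i; have := mono _ _ (prefix_rcons v i); rewrite /rho size_rcons => h1.
  by rewrite addnS ltnS leq_add2r leq_mul.
pose M := (\max_(z : N.-bseq 'I_b.+1) rho z).+1.
have hM v : size v < N -> rho v < M.
  move=> /ltnW sv; rewrite ltnS.
  exact: (leq_bigmax (F := fun z : N.-bseq 'I_b.+1 => rho z) (Bseq sv)).
have [G1 sp1] := emb_space inc hM.
exists M => c Gc.
have [tau0 [G0 [sp0 _ _ hlab col]]] :=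
  cone [::] erefl (fun=> fun=> None) _ (Good_act _ _ _ _ _ sp1 Gc).
rewrite !cdom_lev in sp0 col.
exists (emb_rec rho \o tau0), (fun u => obind G0 (G1 u)); split.
- exact: comp_space sp0 sp1.
- move=> v w vw wh; have vh := ltn_trans vw wh; rewrite /= !size_emb // /rho.
  have := hlab v vh; have := hlab w wh; rewrite /= !drop0 => -> ->.
  have h1 : size (tau0 v) < N := space_raw sp0 vh.
  apply: leq_trans (leq_trans (leq_mul vw (leqnn N.+1)) (leq_addr _ _)).
  by rewrite mulSn addnC ltn_add2r ltnW.
move=> f f' vf vf' sf sf' hR; rewrite !act_comp.
by apply: (col tt) => // u; rewrite prefix0s.
Qed.

(** The second round demands invariance for all valid configurations, the first provides it for
    supported ones. The action reads only indices of bounded height, so truncation leaves it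
    unchanged. *)
Definition restr h f : conf := fun u => if size u < h then f u else None.

Lemma sim_space h : exists N, forall c, exists tau G,
  [/\ space (lev h) (lev N) tau G, level_mono h tau
    & forall f f', valid f -> valid f' -> supp (lev h) f -> supp (lev h) f' ->
      sim h (tops f [::]) (tops f' [::]) -> c (act tau G f) = c (act tau G f')].
Proof.
have [N2 HN2] := normalize (@off_path_invariant_act b C) (@sim_theorem b C h).
(* The first round has to provide the raw height [N2] in which the second one works. *)
have [N1 HN1] := normalize (fun _ _ _ _ _ _ _ => I) (@off_path_theorem b C N2).
exists N1 => c; have [tau1 [G1 [sp1 mono1 col1]]] := HN1 c I.
have restrE f : act tau1 G1 (restr N2 f) = act tau1 G1 f.
  apply: functional_extensionality => u; rewrite /act; case E: (G1 u) => [v|] //.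
  by rewrite /restr (space_dom sp1 E : size v < N2).
have restr_valid f : valid f -> valid (restr N2 f).
  move=> vf u w; rewrite /restr; case: ifP => // su /vf[wu fw]; split=> //.
  by rewrite (leq_ltn_trans (size_prefix wu) su : size w < N2).
have restr_supp f : supp (lev N2) (restr N2 f).
  by move=> u; rewrite /restr /lev; case: ifP.
have inv : off_path_invariant (fun f => c (act tau1 G1 f)).
  move=> f g vf vg hfg; rewrite -(restrE f) -(restrE g); apply: col1; auto.
  have cl f0 u : clear f0 u -> clear (restr N2 f0) u.
    by move=> h0 w uw; rewrite /restr; case: ifP => // _; apply: h0.
  move=> u _; case: (hfg u) => [E|[cf cg]]; first by left; rewrite /restr E.
  by right; split; apply: cl.
have [tau2 [G2 [sp2 mono2 col2]]] := HN2 _ inv.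
exists (tau1 \o tau2), (fun u => obind G2 (G1 u)); split.
- exact: comp_space sp2 sp1.
- move=> v w vw wh; apply: mono1; first exact: mono2.
  exact: (space_raw sp2 wh).
by move=> f f' vf vf' sf sf' hs; rewrite !act_comp; apply: col2.
Qed.

Definition tree_shape k s f : Prop :=
  stepwise (lev k) s /\ forall u, f u = Some u <-> exists2 v, size v < k & u = s v.

(** Both trees are climbed in parallel, [p] and [p'] having equal lengths and lying below the images
    of the same index [v]. These images have equal lengths and are reached together; before that
    each tree continues in a single direction, which [sim] allows to differ. *)
Lemma sim_shape k s s' f f' h : tree_shape k s f -> tree_shape k s' f' -> 0 < k ->
  (forall v, size v < k -> size (s v) = size (s' v)) ->
  sim h (tops f [::]) (tops f' [::]).
Proof.
move=> [st hf] [st' hf'] k0 hs.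
have empty p p' n :
  (forall u, prefix p u -> f u <> Some u) -> (forall u, prefix p' u -> f' u <> Some u) ->
  sim n (tops f p) (tops f' p').
  move=> h1 h2; apply: sim_none => r; apply/eqP; [apply: h1|apply: h2];
  exact: prefix_prefix.
have cons_tops g p i : (fun r => tops g p (i :: r)) = tops g (rcons p i).
  by apply: functional_extensionality => r; rewrite /tops cat_rcons.
have main n p p' v : size v < k -> size p = size p' -> prefix p (s v) -> prefix p' (s' v) ->
  (forall u, prefix p u -> f u = Some u ->
     exists2 r, size (v ++ r) < k & u = s (v ++ r)) ->
  (forall u, prefix p' u -> f' u = Some u ->
     exists2 r, size (v ++ r) < k & u = s' (v ++ r)) ->
  sim n (tops f p) (tops f' p').
  elim: n p p' v => //= n IH p p' v sv pp' hp hp' hu hu'.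
  have below (r0 q : T) i j (z : T) : prefix (rcons q i) z -> z = q ++ j :: r0 -> j = i.
    by move=> h1 Ez; apply: (prefix_rcons_inj _ h1); rewrite Ez -cat_rcons prefix_prefix.
  have mono_s r : size (v ++ r) < k -> prefix (s v) (s (v ++ r)).
    by move=> h1; apply: (step_mono (@lev_down k) st) => //; apply: prefix_prefix.
  have mono_s' r : size (v ++ r) < k -> prefix (s' v) (s' (v ++ r)).
    by move=> h1; apply: (step_mono (@lev_down k) st') => //; apply: prefix_prefix.
  have [Ep|ne] := eqVneq p (s v).
    have Ep' : p' = s' v.
      by apply: (prefix_size_eq hp'); rewrite -pp' Ep hs.
    left; split; first by apply/eqP; rewrite cats0; apply/hf; exists v.
      by apply/eqP; rewrite cats0; apply/hf'; exists v.
    move=> i; rewrite !cons_tops.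
    have next g z q (s0 : T -> T) : stepwise (lev k) s0 -> q = s0 v ->
        (forall u, prefix q u -> g u = Some u ->
           exists2 r, size (v ++ r) < k & u = s0 (v ++ r)) ->
        prefix (rcons q i) z -> g z = Some z ->
        exists2 r, size (rcons v i ++ r) < k & z = s0 (rcons v i ++ r).
      move=> st0 Eq hg qz gz.
      have [[|j r] sr Ez] := hg z (prefix_trans (prefix_rcons _ _) qz) gz.
        by move: qz; rewrite Ez cats0 -Eq => /size_prefix; rewrite size_rcons ltnn.
      suff <- : j = i by exists r; rewrite cat_rcons.
      apply: (prefix_rcons_inj _ qz); rewrite Ez Eq.
      apply: (step_mono_rcons (@lev_down k) st0) => //.
      by rewrite -cat_rcons prefix_prefix.
    have [lt|ge] := ltnP (size v).+1 k.
      have lt' : lev k (rcons v i) by rewrite /lev size_rcons.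
      apply: (IH _ _ (rcons v i)) => //.
      - by rewrite !size_rcons pp'.
      - by rewrite Ep; apply: st.
      - by rewrite Ep'; apply: st'.
      - by move=> u; apply: (next f).
      by move=> u; apply: (next f').
    apply: empty.
      move=> u pu /(next _ _ _ _ st Ep hu pu)[r]; rewrite size_cat size_rcons; lia.
    move=> u pu /(next _ _ _ _ st' Ep' hu' pu)[r]; rewrite size_cat size_rcons; lia.
  have ne' : p' != s' v.
    apply: contra ne => /eqP E; apply/eqP; apply: (prefix_size_eq hp).
    by rewrite pp' E hs.
  have [i hi] := prefix_strict hp ne; have [i' hi'] := prefix_strict hp' ne'.
  have above g q z (s0 : T -> T) i0 : prefix (rcons q i0) (s0 v) ->
      (forall r, size (v ++ r) < k -> prefix (s0 v) (s0 (v ++ r))) ->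
      (forall u, prefix q u -> g u = Some u ->
         exists2 r, size (v ++ r) < k & u = s0 (v ++ r)) ->
      prefix q z -> g z = Some z -> prefix (rcons q i0) z.
    move=> hq hm hg qz gz; have [r sr ->] := hg z qz gz.
    exact: prefix_trans hq (hm r sr).
  right; split.
  - apply/eqP; rewrite cats0 => gp.
    have := above f p p s i hi mono_s hu (prefix_refl p) gp.
    by move/size_prefix; rewrite size_rcons ltnn.
  - apply/eqP; rewrite cats0 => gp.
    have := above f' p' p' s' i' hi' mono_s' hu' (prefix_refl p') gp.
    by move/size_prefix; rewrite size_rcons ltnn.
  exists i, i'; split.
  - move=> j r ji; apply/eqP=> gp; apply: ji.
    apply: (below r p i j (p ++ j :: r)) => //.
    by apply: (above f p _ s i) => //; apply: prefix_prefix.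
  - move=> j r ji; apply/eqP=> gp; apply: ji.
    apply: (below r p' i' j (p' ++ j :: r)) => //.
    by apply: (above f' p' _ s' i') => //; apply: prefix_prefix.
  rewrite !cons_tops; apply: (IH _ _ v) => //.
  - by rewrite !size_rcons pp'.
  - by move=> u pu; apply: hu; apply: prefix_trans (prefix_rcons _ _) pu.
  by move=> u pu; apply: hu'; apply: prefix_trans (prefix_rcons _ _) pu.
apply: (main _ _ _ [::]) => //; try exact: prefix0s.
  by move=> u _ /hf[v sv ->]; exists v.
by move=> u _ /hf'[v sv ->]; exists v.
Qed.

(* Rank of a node in the level-by-level, lexicographic enumeration of the tree. *)
Definition bf v : nat := foldl (fun n (i : 'I_b.+1) => n * b.+1 + i.+1) 0 v.

Lemma bf_rcons v i : bf (rcons v i) = bf v * b.+1 + i.+1.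
Proof. by rewrite /bf foldl_rcons. Qed.

Lemma bf_ltn_cat v w r r' : size r = size r' -> bf v < bf w -> bf (v ++ r) < bf (w ++ r').
Proof.
elim: r r' v w => [|i r IH] [|j r'] v w //=; first by rewrite !cats0.
move=> [sr] vw; rewrite -!cat_rcons; apply: IH => //; rewrite !bf_rcons.
have h := leq_mul vw (leqnn b.+1); rewrite mulSn addnC in h.
apply: leq_ltn_trans (leq_trans _ h) _; last by rewrite -[X in X < _]addn0 ltn_add2l.
by rewrite leq_add2l.
Qed.

Lemma bf_size v w : size v < size w -> bf v < bf w.
Proof.
move=> vw; rewrite -[v]cat0s -(cat_take_drop (size w - size v) w).
apply: bf_ltn_cat; first by rewrite size_drop subKn // ltnW.
have : 0 < size (take (size w - size v) w) by rewrite size_takel ?subn_gt0 ?leq_subr.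
by case/lastP: (take _ w) => // u i _; rewrite bf_rcons addnS.
Qed.

Lemma bf_lex u v w i j : prefix (rcons u i) v -> prefix (rcons u j) w -> i < j ->
  size v = size w -> bf v < bf w.
Proof.
case/prefixP=> r -> /prefixP[r' ->] ij; rewrite !size_cat !size_rcons => /addnI sr.
by apply: bf_ltn_cat => //; rewrite !bf_rcons ltn_add2l.
Qed.

Lemma bf_total v w : v != w -> bf v < bf w \/ bf w < bf v.
Proof.
move=> ne; have [lt|lt|E] := ltngtP (size v) (size w).
- by left; apply: bf_size.
- by right; apply: bf_size.
case: (prefix_split v w) => [h|h|[x [i [j [ij hi hj]]]]].
- by rewrite (prefix_size_eq h) ?E ?eqxx // in ne.
- by rewrite (prefix_size_eq h) ?E ?eqxx // in ne.
have [lt|gt|/val_inj Eij] := ltngtP i j; last by rewrite Eij eqxx in ij.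
- by left; apply: bf_lex hi hj lt E.
- by right; apply: bf_lex hj hi gt (esym E).
Qed.

Lemma bf_inj : injective bf.
Proof.
by move=> v w E; apply/eqP/negPn/negP=> /bf_total; rewrite E ltnn; case.
Qed.

Definition nodes k : seq T :=
  sort (fun v w => bf v <= bf w)
    [seq val z | z <- enum {: k.-bseq 'I_b.+1} & size (val z) < k].

Lemma mem_nodes k v : (v \in nodes k) = (size v < k).
Proof.
rewrite mem_sort; apply/mapP/idP => [[z]|lt]; first by rewrite mem_filter => /andP[lt _] ->.
by exists (Bseq (ltnW lt)); rewrite // mem_filter mem_enum andbT.
Qed.

Lemma nodes_sorted k : sorted (fun v w => bf v < bf w) (nodes k).
Proof.
suff : sorted ltn (map bf (nodes k)) by rewrite sorted_map.
rewrite ltn_sorted_uniq_leq; apply/andP; split.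
  rewrite (map_inj_uniq bf_inj) sort_uniq map_inj_uniq; last exact: val_inj.
  by rewrite filter_uniq ?enum_uniq.
by rewrite sorted_map; apply: sort_sorted => v w; apply: leq_total.
Qed.

Lemma sorted_subseq_ltn (l l' : seq nat) : sorted ltn l -> sorted ltn l' ->
  {subset l <= l'} -> subseq l l'.
Proof.
move=> sl sl' sub; suff -> : l = filter (fun x => x \in l) l' by apply: filter_subseq.
apply: (irr_sorted_eq ltn_trans ltnn) => //; first by apply: sorted_filter => //; exact: ltn_trans.
by move=> x; rewrite mem_filter andb_idr //; apply: sub.
Qed.

Definition depths k s : seq nat := [seq size (s v) | v <- nodes k].

Lemma depths_eq k s s' : depths k s = depths k s' ->
  forall v, size v < k -> size (s v) = size (s' v).
Proof. by move/eq_in_map=> h v sv; apply: h; rewrite mem_nodes. Qed.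

(** Inside the space from [sim_space] the colour depends only on [depths]. The indices are placed,
    by rank, on levels from a set homogeneous for this colour, so the depths of every tree inside
    form a subset of that set. *)
Theorem tree_ramsey k m : 0 < k -> exists N, forall c, exists tau G (i : C),
  [/\ space (lev m) (lev N) tau G,
      forall v w, size v < m -> size w < m -> bf v < bf w -> size (tau v) < size (tau w)
    & forall f s, valid f -> supp (lev m) f -> tree_shape k s f ->
      (forall v w, size v < k -> size w < k -> bf v < bf w -> bf (s v) < bf (s w)) ->
      c (act tau G f) = i].
Proof.
move=> k0; pose M := (\max_(z : m.-bseq 'I_b.+1) bf z).+1.
have hM v : size v < m -> bf v < M.
  move=> /ltnW sv; rewrite ltnS.
  exact: (leq_bigmax (F := fun z : m.-bseq 'I_b.+1 => bf z) (Bseq sv)).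
pose K := size (nodes k).
(* [M] levels give each node below height [m] its own; a tree occupies [K] of them. *)
have [h Hh] := finite_ramsey C K M.
have [N HN] := sim_space h.
exists N => c; have [tau [G [sp mono col]]] := HN c.
pose good l f s := [/\ valid f, supp (lev h) f, tree_shape k s f & depths k s = l].
have inhC : inhabited C by constructor; exact: c (fun=> None).
(* [colorE] shows that all configurations with depths [l] share this colour; a list realised by none
   receives an arbitrary one. *)
pose color l := epsilon inhC (fun i => exists f s, good l f s /\ c (act tau G f) = i).
have colorE l f s : good l f s -> color l = c (act tau G f).
  move=> gf; have := epsilon_spec inhC
    (fun i => exists f s, good l f s /\ c (act tau G f) = i).
  rewrite -/(color l) => /(_ (ex_intro _ _ (ex_intro _ f (ex_intro _ s (conj gf erefl))))).
  case=> f' [s' [[vf' sf' sh' d'] <-]]; case: gf => vf sf sh d.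
  apply: col => //; apply: (sim_shape h sh' sh k0); apply: depths_eq.
  by rewrite d d'.
have [t [ts st hom]] := Hh (iota 0 h) color (eq_leq (esym (size_iota 0 h))).
have t_sorted : sorted ltn t := subseq_sorted ltn_trans ts (iota_ltn_sorted 0 h).
have t_lt n : n < size t -> nth 0 t n < h.
  move=> lt; have := mem_subseq ts (mem_nth 0 lt).
  by rewrite mem_iota.
(* Below height [m] the rank never exceeds the list [t]; the other branch only keeps [rho]
   increasing everywhere. *)
pose rho v := if bf v < size t then nth 0 t (bf v) else h + bf v.
have rho_mono v w : bf v < bf w -> rho v < rho w.
  move=> vw; rewrite /rho; case: (ltnP (bf w)) => hw.
    rewrite (ltn_trans vw hw); apply: (sorted_ltn_nth ltn_trans) => //.
    by rewrite inE (ltn_trans vw hw).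
  case: ifP => [lt|_]; last by rewrite ltn_add2l.
  by apply: leq_trans (t_lt _ lt) (leq_addr _ _).
have inc : increasing rho.
  by move=> v i; apply: rho_mono; apply: bf_size; rewrite size_rcons.
have rho_lt v : size v < m -> rho v < h.
  by move=> sv; rewrite /rho st hM //; apply: t_lt; rewrite st hM.
have [G3 sp3] := emb_space inc rho_lt.
exists (tau \o emb_rec rho), (fun u => obind G3 (G u)), (color (take K t)); split.
- exact: comp_space sp3 sp.
- move=> v w sv sw vw; apply: mono; first by rewrite !size_emb // rho_mono.
  exact: (space_raw sp3 sw).
move=> f s vf sf [stf hf] sbf; rewrite act_comp.
have sm v : size v < k -> size (s v) < m.
  move=> sv; have fs : f (s v) = Some (s v) by apply/hf; exists v.
  by have := sf (s v); rewrite fs; apply.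
set g := act (emb_rec rho) G3 f.
have gg : good (depths k (emb_rec rho \o s)) g (emb_rec rho \o s).
  split=> //; [exact: (act_valid sp3)|exact: (act_supp sp3)|split].
    move=> v i hv; have lt : lev m (s (rcons v i)) by apply: sm.
    apply: (step_mono_rcons (@lev_down m) (emb_step inc)) => //.
    exact: stf.
  move=> u; split=> [/(act_top sp3 vf)[w [_ -> /hf[v sv ->]]]|[v sv ->]]; first by exists v.
  rewrite /g /= (act_tau sp3); last exact: sm.
  by have -> : f (s v) = Some (s v) by apply/hf; exists v.
have size_d s0 : size (depths k s0) = K by rewrite size_map.
(* [s] respects ranks and [rho] is increasing in the rank, so the depths are listed in increasing
   order. *)
have sub : subseq (depths k (emb_rec rho \o s)) t.
  apply: sorted_subseq_ltn => //.
    apply: (homo_sorted_in (P := fun v => size v < k)) (nodes_sorted k).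
      by move=> v w sv sw vw /=; rewrite !size_emb // rho_mono // sbf.
    by apply/allP=> v; rewrite mem_nodes.
  move=> x /mapP[v]; rewrite mem_nodes => sv -> /=; rewrite size_emb // /rho st hM ?sm //.
  by apply: mem_nth; rewrite st hM ?sm.
have Kt : K <= size t by rewrite -(size_d (emb_rec rho \o s)) size_subseq.
rewrite -(colorE _ _ _ gg); apply: hom => //; first exact: subseq_take.
exact: size_takel.
Qed.

End Core.

(** * Complete skew subtrees *)

Section Nodes.
Variables (b n : nat).
Notation T := (seq 'I_b.+1).
Notation node := (node b.+1 n).
Implicit Types (v w x : T) (s t u : node) (S X : {set node}) (i j : 'I_b.+1).

Lemma node_seq_inj : injective (@node_seq b.+1 n).
Proof. by move=> s t E; apply/val_inj/val_inj. Qed.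

Lemma node_of v : size v < n -> exists s, node_seq s = v.
Proof.
move=> sv; have sz : size (Bseq (ltnW sv)) < n by [].
by exists (exist _ (Bseq (ltnW sv)) sz).
Qed.

Lemma ini_anti s t : ini s t -> ini t s -> s = t.
Proof. by move=> h1 h2; apply: node_seq_inj; apply: prefix_anti. Qed.

Lemma sini_ltn s t : sini s t -> len s < len t.
Proof.
case/andP=> st ne; rewrite ltnNge; apply: contra ne => le; apply/eqP/node_seq_inj.
exact: prefix_size_eq st le.
Qed.

Lemma sini_trans s t u : sini s t -> sini t u -> sini s u.
Proof.
move=> h1 h2; have := ltn_trans (sini_ltn h1) (sini_ltn h2).
case/andP: h1 => h1 _; case/andP: h2 => h2 _ lt.
rewrite /sini /ini (prefix_trans h1 h2) /=; apply/eqP=> E; by rewrite E ltnn in lt.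
Qed.

Section Branching.
Variables (s t : node) (x : T) (i j : 'I_b.+1).
Hypotheses (ij : i != j) (xs : prefix (rcons x i) (node_seq s))
  (xt : prefix (rcons x j) (node_seq t)).

Lemma branch_lcs : lcs s t = size x.
Proof.
have lt : size x < (len s).+1.
  by have := size_prefix xs; rewrite size_rcons => /ltnW.
apply/eqP; rewrite eqn_leq; apply/andP; split.
  apply/bigmax_leqP => k hk; rewrite leqNgt; apply/negP=> xk.
  have h : prefix (rcons x i) (take k (node_seq s)).
    case/prefixP: xs => r ->; rewrite prefixE take_takel ?size_rcons //.
    by rewrite -(size_rcons x i) take_size_cat // eqxx.
  by move: ij; rewrite (prefix_rcons_inj (prefix_trans h hk) xt) eqxx.
apply: (@leq_bigmax_cond _ _ _ (Ordinal lt)) => /=.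
have xs' := prefix_trans (prefix_rcons x i) xs.
move: xs'; rewrite prefixE => /eqP ->.
exact: prefix_trans (prefix_rcons x j) xt.
Qed.

Lemma branch_entry u l : prefix (rcons x l) (node_seq u) -> entry u (size x) = l.
Proof.
by case/prefixP=> r E; rewrite /entry E cat_rcons map_cat nth_cat size_map ltnn subnn.
Qed.

Lemma branch_incomparable : ~~ ini s t && ~~ ini t s.
Proof.
apply/andP; split; apply/negP=> h; move: ij.
  by rewrite (prefix_rcons_inj (prefix_trans xs h) xt) eqxx.
by rewrite (prefix_rcons_inj xs (prefix_trans xt h)) eqxx.
Qed.

Lemma branch_lexle : lexle s t = (i < j).
Proof.
case/andP: branch_incomparable => h1 h2.
by rewrite /lexle (negPf h1) h2 /= branch_lcs (branch_entry xs) (branch_entry xt).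
Qed.

End Branching.

(** * Images of the full tree are complete skew subtrees *)

Section Image.
Variables (m : nat) (tau : T -> T) (e : T -> node).
Hypotheses (m0 : 0 < m) (step : stepwise (lev m) tau)
  (inc : forall v w, size v < m -> size w < m -> bf v < bf w -> size (tau v) < size (tau w))
  (eE : forall v, size v < m -> node_seq (e v) = tau v).
Variable S : {set node}.
Hypothesis SP : forall t, t \in S <-> exists2 v, size v < m & t = e v.

Let down := @lev_down b m.

Lemma image_in v : size v < m -> e v \in S.
Proof. by move=> sv; apply/SP; exists v. Qed.

Lemma image_ini v w : size v < m -> size w < m -> ini (e v) (e w) = prefix v w.
Proof.
move=> sv sw; rewrite /ini !eE //; apply/idP/idP; last exact: (step_mono down step).
exact: (step_reflect down step).
Qed.

Lemma image_inj v w : size v < m -> size w < m -> e v = e w -> v = w.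
Proof.
by move=> sv sw E; apply: prefix_anti; rewrite -image_ini // E /ini prefix_refl.
Qed.

Lemma image_sini v w : size v < m -> size w < m -> sini (e v) (e w) = prefix v w && (v != w).
Proof.
move=> sv sw; rewrite /sini image_ini //; congr (_ && ~~ _).
by apply/eqP/eqP => [/image_inj->|->].
Qed.

Lemma image_height v : size v < m -> height S (e v) = size v.
Proof.
move=> sv; have st (q : nat) : size (take q v) < m.
  by apply: leq_ltn_trans sv; apply: size_prefix; apply: prefix_take.
have -> : height S (e v) = #|[set e (take i v) | i : 'I_(size v)]|.
  congr #|pred_of_set _|; apply/setP=> t; rewrite inE; apply/andP/imsetP.
    case=> /SP[w sw ->]; rewrite image_sini // => /andP[wv ne].
    have lt : size w < size v.
      by rewrite ltnNge; apply: contra ne => le; rewrite (prefix_size_eq wv le).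
    by exists (Ordinal lt) => //=; move: wv; rewrite prefixE => /eqP->.
  case=> i _ ->; split; first exact: image_in.
  rewrite image_sini // prefix_take /=; apply/eqP=> /(congr1 size); rewrite size_takel 1?ltnW // => E.
  by have := ltn_ord i; rewrite [X in X < _]E ltnn.
rewrite card_imset ?card_ord // => i j /(image_inj (st _) (st _)) /(congr1 size).
by rewrite !size_takel 1?ltnW // => /val_inj.
Qed.

Lemma image_complete_skew : complete_skew m S.
Proof.
split.
- exists (e [::]); split; first exact: image_in.
  by move=> _ /SP[v sv ->]; rewrite image_ini ?prefix0s.
- move=> X maxX; have /maxsetP[/andP[/subsetP XS /forall_inP chX] max] := maxX.
  have [v sv hv] : exists2 v, size v < m & forall w, size w < m -> e w \in X -> prefix w v.
    have [->|[t0 t0X]] := set_0Vmem X; first by exists [::] => // w _; rewrite inE.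
    case: (arg_maxnP (@len _ _) t0X) => t tX ht; have /SP[v sv Et] := XS _ tX.
    exists v => // w sw wX; have := ht _ wX; rewrite Et /len !eE // => le.
    have /forall_inP /(_ _ tX) := chX _ wX; rewrite Et !image_ini //.
    case/orP=> // vw; have := step_mono down step sw vw.
    by move=> /prefix_size_eq /(_ le) /(step_inj down step sv sw) ->; apply: prefix_refl.
  (* Prolonging [v] to the top level gives a chain of [m] nodes containing [X], hence equal to it by
     maximality. *)
  pose v' := v ++ nseq (m.-1 - size v) ord0.
  have sv' : size v' = m.-1 by rewrite size_cat size_nseq; lia.
  have st (q : nat) : size (take q v') < m.
    by rewrite size_take_min sv'; apply: leq_ltn_trans (geq_minr _ _) _; rewrite prednK.
  pose Y := [set e (take i v') | i : 'I_m].
  have XY : X = Y.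
    apply/esym; apply: max; last first.
      apply/subsetP=> t tX; have /SP[w sw Et] := XS _ tX; rewrite Et in tX *.
      have wv := hv _ sw tX; apply/imsetP; exists (Ordinal sw) => //=.
      by move: (prefix_catl (nseq (m.-1 - size v) ord0) wv); rewrite prefixE => /eqP->.
    apply/andP; split; first by apply/subsetP=> _ /imsetP[i _ ->]; apply: image_in.
    apply/forall_inP=> _ /imsetP[i _ ->]; apply/forall_inP=> _ /imsetP[j _ ->].
    by rewrite !image_ini //; apply: (prefix_total (prefix_take _ _) (prefix_take _ _)).
  rewrite XY card_imset ?card_ord // => i j /(image_inj (st _) (st _)) /(congr1 size).
  rewrite !size_takel => [/val_inj //||]; rewrite sv' -ltnS prednK //; exact: ltn_ord.
- move=> _ _ /SP[v sv ->] /SP[w sw ->]; rewrite !image_height // => E.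
  rewrite /len !eE //; case: (prefix_split v w) => [h|h|[x [i [j [ij hi hj]]]]].
  + by rewrite (prefix_size_eq h) ?E.
  + by rewrite (prefix_size_eq h) ?E.
  rewrite (branch_lexle ij (x := tau x)) ?eE //; try exact: (step_mono_rcons down step).
  by move=> lt; apply: ltnW; apply: inc => //; apply: bf_lex hi hj lt E.
- move=> _ _ /SP[v sv ->] /SP[w sw ->]; rewrite !image_height // => vw.
  by rewrite /len !eE //; apply: inc => //; apply: bf_size.
move=> _ /SP[v sv ->] [_ /SP[w sw ->]]; rewrite image_sini // => /andP[vw ne] i.
have lt : size (rcons v i) < m.
  rewrite size_rcons; apply: leq_ltn_trans sw; rewrite ltnNge; apply: contra ne => le.
  by rewrite (prefix_size_eq vw le).
exists (e (rcons v i)); split.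
  split; last by rewrite !eE //; apply: step.
  rewrite inE image_in // image_sini // prefix_rcons /=; apply/andP; split.
    by apply/eqP=> /(congr1 size)/eqP; rewrite size_rcons ltn_eqF.
  apply/exists_inP=> -[_ /SP[w' sw' ->]]; rewrite !image_sini // => /andP[/andP[h1 n1] /andP[h2 n2]].
  move: h2; rewrite prefix_rconsE (negPf n2) /= => h2.
  by rewrite (prefix_anti h1 h2) eqxx in n1.
move=> t' []; rewrite inE => /andP[/SP[w' sw' ->] /andP[]].
rewrite image_sini // => /andP[h1 n1] /exists_inP no; rewrite !eE // => h2.
have [j h3] := prefix_strict h1 n1.
have Ej := prefix_rcons_inj h2 (step_mono_rcons down step sw' h3); rewrite -Ej in h3.
congr e; apply/eqP; apply: contraT => n3; case: no; exists (e (rcons v i)).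
  exact: image_in.
rewrite !image_sini // h3 n3 prefix_rcons /= andbT.
by apply/eqP=> /(congr1 size)/eqP; rewrite size_rcons ltn_eqF.
Qed.

End Image.

(** * Every complete skew subtree is indexed by the full tree *)

Section Enumeration.
Variables (k : nat) (S : {set node}).
Hypotheses (k0 : 0 < k) (skew : complete_skew k S).

Lemma PredP s t : reflect (t \in S /\ sini t s) (t \in Pred S s).
Proof. by rewrite inE; apply: andP. Qed.

Lemma Pred_chain s : s \in S -> chain_of S (s |: Pred S s).
Proof.
move=> sS; have below t : t \in s |: Pred S s -> ini t s.
  by case/setU1P=> [->|/PredP[_ /andP[]//]]; apply: prefix_refl.
apply/andP; split.
  by apply/subsetP=> t /setU1P[->//|/PredP[]].
apply/forall_inP=> t /below ts; apply/forall_inP=> u /below us.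
exact: prefix_total ts us.
Qed.

Lemma card_Pred_chain s : #|s |: Pred S s| = (height S s).+1.
Proof. by rewrite cardsU1 inE /sini eqxx andbF andbF. Qed.

Lemma height_ltn s : s \in S -> height S s < k.
Proof.
move=> sS; have [X /(skew_chain skew) <- sX] := maxset_exists (Pred_chain sS).
by rewrite -card_Pred_chain subset_leq_card.
Qed.

Lemma height_max s : s \in S -> (forall t, t \in S -> ~~ sini s t) -> (height S s).+1 = k.
Proof.
move=> sS mx; rewrite -card_Pred_chain; apply: (skew_chain skew).
apply/maxsetP; split; first exact: Pred_chain.
move=> X /andP[/subsetP XS /forall_inP chX] sub; apply/eqP; rewrite eqEsubset sub andbT.
apply/subsetP=> t tX; have sX : s \in X by apply: (subsetP sub); rewrite setU11.
have := forall_inP (chX _ tX) _ sX; rewrite !inE.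
have [->//|ne] := eqVneq t s; rewrite (XS _ tX) /= /sini ne andbT => /orP[//|st].
by have := mx t (XS _ tX); rewrite /sini st eq_sym ne.
Qed.

Lemma ImSucc_height s t : s \in S -> t \in ImSucc S s -> height S t = (height S s).+1.
Proof.
move=> sS; rewrite inE => /and3P[tS st /exists_inP no].
rewrite -card_Pred_chain; congr #|pred_of_set _|; apply/setP=> u; rewrite in_setU1.
apply/PredP/predU1P => [[uS ut]|[->//|/PredP[uS us]]]; last first.
  by split=> //; apply: sini_trans us st.
have [->|ne] := eqVneq u s; first by left.
right; apply/PredP; split=> //; rewrite /sini ne andbT.
case/andP: (ut) => h1 _; case/andP: st => h2 _.
case/orP: (prefix_total h1 h2) => // h3; case: no; exists u => //.
by rewrite ut /sini /ini h3 eq_sym ne.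
Qed.

Definition child s i : node :=
  odflt s [pick t in ImSucc S s | prefix (rcons (node_seq s) i) (node_seq t)].

Lemma childP s i : s \in S -> (height S s).+1 < k ->
  child s i \in ImSucc S s /\ prefix (rcons (node_seq s) i) (node_seq (child s i)).
Proof.
move=> sS lt; have [t tS st] : exists2 t, t \in S & sini s t.
  apply/exists_inP; apply: contraT; rewrite negb_exists_in => /forall_inP mx.
  by rewrite (height_max sS mx) ltnn in lt.
have [t' [[t's pt'] _]] := skew_succ skew sS (ex_intro2 _ _ t tS st) i.
rewrite /child; case: pickP => [u /andP[]//|/(_ t')].
by rewrite t's pt'.
Qed.

Lemma childE s i t : s \in S -> t \in ImSucc S s -> prefix (rcons (node_seq s) i) (node_seq t) ->
  child s i = t.
Proof.
move=> sS ts pt; have tS : t \in S by move: ts; rewrite inE => /andP[].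
have st : sini s t by move: ts; rewrite inE => /and3P[].
have [u [_ uniq]] := skew_succ skew sS (ex_intro2 _ _ t tS st) i.
have lt : (height S s).+1 < k by rewrite -(ImSucc_height sS ts) height_ltn.
by rewrite -(uniq t) //; apply/esym/uniq/childP.
Qed.

(** From the minimum, [g] follows the immediate successors in the given directions, and heights
    become sizes. Each node is reached because its longest predecessor is its parent. The level and
    lexicographic conditions together say that lengths grow weakly with the rank. *)
Lemma complete_skew_enum : exists g : T -> node,
  [/\ forall v, size v < k -> g v \in S,
      forall t, t \in S -> exists2 v, size v < k & t = g v,
      stepwise (lev k) (fun v => node_seq (g v))
    & forall v w, size v < k -> size w < k -> bf v < bf w -> len (g v) <= len (g w)].
Proof.
have [r [rS rmin]] := skew_min skew.
have r0 : height S r = 0.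
  apply/eqP; rewrite cards_eq0; apply/eqP/setP=> t; rewrite in_set0; apply/PredP=> -[tS].
  by case/andP=> tr; rewrite (ini_anti tr (rmin _ tS)) eqxx.
pose g v := foldl child r v.
have g_rcons v i : g (rcons v i) = child (g v) i by rewrite /g foldl_rcons.
have gS v : size v < k -> g v \in S /\ height S (g v) = size v.
  elim/last_ind: v => [|v i IH] //; rewrite size_rcons g_rcons => lt.
  have [gvS hgv] := IH (ltnW lt); have lt' : (height S (g v)).+1 < k by rewrite hgv.
  have [ns _] := childP i gvS lt'.
  by split; [move: ns; rewrite inE => /andP[]|rewrite (ImSucc_height gvS ns) hgv].
have st : stepwise (lev k) (fun v => node_seq (g v)).
  move=> v i; rewrite /lev size_rcons g_rcons => lt; have [gvS hgv] := gS v (ltnW lt).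
  have lt' : (height S (g v)).+1 < k by rewrite hgv.
  by case: (childP i gvS lt').
exists g; split=> // [v /gS[]//|t|v w sv sw vw].
  elim: {t}(height S t) {-2}t (erefl (height S t)) => [|h IH] t ht tS.
    exists [::] => //; apply/eqP; apply: contraT => ne.
    have : r \in Pred S t by apply/PredP; split=> //; rewrite /sini rmin //= eq_sym.
    by move/eqP: ht; rewrite cards_eq0 => /eqP->; rewrite inE.
  have [p0 p0t] : exists p, p \in Pred S t by apply/set0Pn; rewrite -cards_eq0 -/(height S t) ht.
  case: (arg_maxnP (@len _ _) p0t) => p /PredP[pS pt] pmax.
  have tp : t \in ImSucc S p.
    rewrite inE tS pt; apply/exists_inP=> -[u uS /andP[pu ut]].
    have uP : u \in Pred S t by apply/PredP.
    by have /= := pmax u uP; rewrite /geq /= leqNgt (sini_ltn pu).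
  have hp : height S p = h by move: (ImSucc_height pS tp); rewrite ht => -[].
  have [v sv Ep] := IH p hp pS; have /andP[pt1 ptne] := pt.
  have [|i hi] := prefix_strict pt1.
    by apply: contra ptne => /eqP E; apply/eqP/node_seq_inj.
  exists (rcons v i).
    have [_ hv] := gS v sv; rewrite size_rcons -hv -Ep hp -ht; exact: height_ltn.
  by rewrite g_rcons -Ep (childE pS tp hi).
have [gvS hv] := gS v sv; have [gwS hw] := gS w sw.
have [lt|lt|E] := ltngtP (size v) (size w).
- by apply: ltnW; apply: (skew_level skew) => //; rewrite hv hw.
- by have := ltn_trans vw (bf_size lt); rewrite ltnn.
apply: (skew_lex skew) => //; first by rewrite hv hw.
case: (prefix_split v w) => [h|h|[x [i [j [ij hi hj]]]]].
- by rewrite (prefix_size_eq h) ?E // ltnn in vw.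
- by rewrite (prefix_size_eq h) ?E // ltnn in vw.
rewrite (branch_lexle ij (x := node_seq (g x))); first last.
- exact: (step_mono_rcons (@lev_down b k) st).
- exact: (step_mono_rcons (@lev_down b k) st).
rewrite ltnNge leq_eqVlt; apply/negP=> /orP[/eqP/val_inj Eij|lt].
  by rewrite Eij eqxx in ij.
by have := ltn_trans vw (bf_lex hj hi lt (esym E)); rewrite ltnn.
Qed.

End Enumeration.
End Nodes.

(** * Families of sets *)

Section Families.
Variables (b n : nat).
Notation T := (seq 'I_b.+1).
Notation node := (node b.+1 n).
Implicit Types (v w x : T) (s t u : node) (f g z : conf b).

Definition mins z : {set node} := [set t | z (node_seq t) == Some (node_seq t)].

Definition member z t : {set node} := [set u | z (node_seq u) == Some (node_seq t)].

Definition family z : {set {set node}} := [set member z t | t in mins z].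

(** Every index is a minimum, so acting on this configuration gives the space itself. *)
Definition all_self m : conf b := fun v => if size v < m then Some v else None.

Section Spaces.
Variables (m N : nat) (tau : T -> T) (G : T -> option T).
Hypotheses (m0 : 0 < m) (sp : space (lev m) (lev N) tau G) (Nn : N <= n)
  (inc : forall v w, size v < m -> size w < m -> bf v < bf w -> size (tau v) < size (tau w)).

Let z := act tau G (all_self m).

Lemma self_valid : valid (all_self m).
Proof.
move=> v w; rewrite /all_self; case: ifP => // sv [<-].
by rewrite prefix_refl sv.
Qed.

Lemma act_self (y : T) v : size v < m -> z y = Some (tau v) <-> G y = Some v.
Proof.
move=> sv; rewrite /z /act; case E: (G y) => [w|] //.
have sw : size w < m := space_dom sp E.
rewrite /all_self sw /=; split=> [[h]|[->//]].
by rewrite (step_inj (space_down sp) (space_step sp) sw sv h).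
Qed.

Lemma tau_node v : size v < m -> exists s : node, node_seq s = tau v.
Proof.
by move=> sv; apply: node_of; apply: leq_trans Nn; apply: (space_raw sp sv).
Qed.

Lemma mins_self t : t \in mins z <-> exists2 v, size v < m & node_seq t = tau v.
Proof.
rewrite inE; split=> [/eqP/(act_top sp self_valid)[v [sv Et _]]|[v sv Et]]; first by exists v.
by apply/eqP; rewrite Et; apply/act_self => //; apply: (space_fix sp).
Qed.

Lemma family_in_U : in_U m (family z).
Proof.
have [e eE] : exists e : T -> node, forall v, size v < m -> node_seq (e v) = tau v.
  have [s0 _] := tau_node (m0 : size [::] < m).
  exists (fun v => odflt s0 [pick s : node | node_seq s == tau v]) => v sv.
  case: pickP => [s /eqP//|no]; have [s Es] := tau_node sv.
  by have := no s; rewrite Es eqxx.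
have SP t : t \in mins z <-> exists2 v, size v < m & t = e v.
  split=> [/mins_self[v sv Et]|[v sv ->]]; last by apply/mins_self; exists v; rewrite ?eE.
  by exists v => //; apply: node_seq_inj; rewrite eE.
exists (mins z), (member z); split=> //.
- exact: (image_complete_skew m0 (space_step sp) inc eE SP).
- move=> t /mins_self[v sv Et]; split.
    by rewrite inE Et; apply/eqP/act_self => //; apply: (space_fix sp).
  move=> u; rewrite inE Et => /eqP/(act_self _ sv) Gu; rewrite /ini Et.
  by case: (space_mem sp Gu sv).
move=> t t' _ _ ne; apply/pred0P=> u /=; apply/negP; rewrite !inE => /andP[/eqP-> /eqP[E]].
by move: ne; rewrite (node_seq_inj E) eqxx.
Qed.

(** Each member of [P] is a union of blocks of the space, so it is described by the indices of these
    blocks: [f] records for an index the minimum of the member containing its block, and [sg] the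
    indices of the minima. *)
Lemma subspace_family k (P : {set {set node}}) : 0 < k ->
  in_U_of k (family z) P -> exists f (sg : T -> T),
  [/\ valid f, supp (lev m) f, tree_shape k sg f,
      forall v w, size v < k -> size w < k -> bf v < bf w -> bf (sg v) < bf (sg w)
    & P = family (act tau G f)].
Proof.
move=> k0 [[S [Up [skew mn disj PE]]] sub].
have inj v w := step_inj (space_down sp) (space_step sp) (v := v) (w := w).
have union s : s \in S -> exists2 R : {set {set node}}, R \subset family z & Up s = cover R.
  by move=> sS; apply: sub; rewrite PE; apply: imset_f.
have block X u : X \in family z -> u \in X ->
    exists v, [/\ size v < m, G (node_seq u) = Some v & X = [set u' | z (node_seq u') == Some (tau v)]].
  move=> /imsetP[t /mins_self[v sv Et] ->]; rewrite inE Et => /eqP/(act_self _ sv) Gu.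
  by exists v; split=> //; apply/setP=> u'; rewrite !inE Et.
have up_down s u : s \in S -> u \in Up s -> exists v t,
    [/\ size v < m, G (node_seq u) = Some v, node_seq t = tau v & t \in Up s].
  move=> sS; have [R RU ->] := union s sS; case/bigcupP=> X XR uX.
  have [v [sv Gu EX]] := block _ _ (subsetP RU _ XR) uX.
  have [t Et] := tau_node sv; exists v, t; split=> //; apply/bigcupP; exists X => //.
  by rewrite EX inE Et; apply/eqP/act_self => //; apply: (space_fix sp).
have down_up s u v t : s \in S -> size v < m -> node_seq t = tau v -> t \in Up s ->
    G (node_seq u) = Some v -> u \in Up s.
  move=> sS sv Et; have [R RU ->] := union s sS; case/bigcupP=> X XR tX Gu.
  apply/bigcupP; exists X => //; have [w [sw Gt EX]] := block _ _ (subsetP RU _ XR) tX.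
  move: Gt; rewrite Et (space_fix sp sv) => -[Evw].
  by rewrite EX inE -Evw; apply/eqP/act_self.
(* The block containing [s] lies inside [Up s] and its minimum is a prefix of [s]; as [s] is the
   minimum of [Up s], the two agree. *)
have S_tau s : s \in S -> exists2 v, size v < m & node_seq s = tau v.
  move=> sS; have [sU smin] := mn _ sS; have [v [t [sv Gs Et tU]]] := up_down _ _ sS sU.
  exists v => //; rewrite -Et; congr node_seq; apply: ini_anti; first exact: smin.
  by rewrite /ini Et; case: (space_mem sp Gs sv).
have up_uniq s s' u : s \in S -> s' \in S -> u \in Up s -> u \in Up s' -> s = s'.
  move=> sS s'S us us'; apply/eqP; apply: contraT => ne.
  by have := disjointFr (disj _ _ sS s'S ne) us; rewrite us'.
pose ok v s := (s \in S) && [exists t, (node_seq t == tau v) && (t \in Up s)].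
pose f v := if size v < m then
  if [pick s | ok v s] is Some s then G (node_seq s) else None else None.
have okP v s : reflect (s \in S /\ exists2 t, node_seq t = tau v & t \in Up s) (ok v s).
  apply: (iffP andP) => -[sS ht]; split=> //.
    by case/existsP: ht => t /andP[/eqP Et tU]; exists t.
  by case: ht => t Et tU; apply/existsP; exists t; rewrite Et eqxx tU.
have fE v x : f v = Some x <-> [/\ size v < m, size x < m & exists s, [/\ s \in S,
    node_seq s = tau x & exists2 t, node_seq t = tau v & t \in Up s]].
  rewrite /f; split.
    case: ifP => // sv; case: pickP => // s /okP[sS ht] Gs; have [w sw Es] := S_tau _ sS.
    move: Gs; rewrite Es (space_fix sp sw) => -[<-]; split=> //.
    by exists s.
  case=> sv sx [s [sS Es [t Et tU]]]; rewrite sv.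
  case: pickP => [s' /okP[s'S [t' Et' t'U]]|/(_ s)/okP[]]; last by split=> //; exists t.
  have Ett : t' = t by apply: node_seq_inj; rewrite Et Et'.
  by rewrite Ett in t'U; rewrite (up_uniq _ _ _ s'S sS t'U tU) Es (space_fix sp sx).
have [g [gS gsurj gstep gbf]] := complete_skew_enum k0 skew.
pose sa v := odflt [::] (G (node_seq (g v))).
have saP v : size v < k -> size (sa v) < m /\ node_seq (g v) = tau (sa v).
  move=> /gS/S_tau[w sw Eg]; rewrite /sa Eg (space_fix sp sw) /=.
  by split.
exists f, sa; split.
- move=> v x /fE[sv sx [s [sS Es [t Et tU]]]]; split.
    apply: (step_reflect (space_down sp) (space_step sp)) => //; rewrite -Es -Et.
    by have [_ h] := mn _ sS; apply: h.
  by apply/fE; split=> //; exists s; split=> //; exists s => //; case: (mn _ sS).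
- by move=> v; rewrite /f /lev; case: ifP.
- split.
    move=> v i lt; have [h1 h2] := saP _ lt.
    have [h3 h4] := saP v (@lev_down b k _ _ lt (prefix_rcons v i)).
    have h := gstep v i lt; rewrite h2 h4 in h.
    have pf : prefix (sa v) (sa (rcons v i)).
      apply: (step_reflect (space_down sp) (space_step sp)) => //.
      exact: prefix_trans (prefix_rcons _ _) h.
    have [|j hj] := prefix_strict pf.
      apply/eqP=> E; move: h; rewrite -E => /size_prefix.
      by rewrite size_rcons ltnn.
    have h' := step_mono_rcons (space_down sp) (space_step sp) h1 hj.
    by rewrite -(prefix_rcons_inj h h') in hj.
  move=> u; split=> [/fE[su _ [s [sS Es _]]]|[v sv ->]].
    have [v sv Eg] := gsurj _ sS; exists v => //; have [h1 h2] := saP _ sv.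
    by apply: inj => //; rewrite -Es Eg.
  have [h1 h2] := saP _ sv; apply/fE; split=> //; exists (g v); split=> //; first exact: gS.
  by exists (g v) => //; case: (mn _ (gS _ sv)).
- move=> v w sv sw vw; have [h1 h2] := saP _ sv; have [h3 h4] := saP _ sw.
  have le : size (tau (sa v)) <= size (tau (sa w)) by rewrite -h2 -h4; apply: gbf.
  have ne : sa v != sa w.
    apply/eqP=> E; have := step_inj (@lev_down b k) gstep sv sw.
    by rewrite h2 h4 E => /(_ erefl) Evw; rewrite Evw ltnn in vw.
  (* The skew tree gives a weak inequality of lengths only, but lengths in the space grow strictly
     with the rank, which excludes the opposite order. *)
  case: (bf_total ne) => // lt; have := inc h3 h1 lt.
  by rewrite ltnNge le.
have memE u s : s \in S -> (act tau G f (node_seq u) == Some (node_seq s)) = (u \in Up s).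
  move=> sS; rewrite /act; apply/eqP/idP.
    case Gu: (G (node_seq u)) => [v|] //; case E: (f v) => [x|] //= [Es].
    have /fE[sv sx [s' [s'S Es' [t Et tU]]]] := E.
    have <- : s' = s by apply: node_seq_inj; rewrite Es'.
    exact: down_up tU Gu.
  move=> uU; have [v [t [sv Gu Et tU]]] := up_down _ _ sS uU; rewrite Gu.
  have [x sx Es] := S_tau _ sS.
  have -> : f v = Some x by apply/fE; split=> //; exists s; split=> //; exists t.
  by rewrite /= Es.
have minsE : mins (act tau G f) = S.
  apply/setP=> s; rewrite inE; apply/eqP/idP => [E|sS].
    have vf : valid f.
      move=> v x /fE[sv sx [s' [sS Es [t Et tU]]]]; split.
        apply: (step_reflect (space_down sp) (space_step sp)) => //; rewrite -Es -Et.
        by have [_ h] := mn _ sS; apply: h.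
      by apply/fE; split=> //; exists s'; split=> //; exists s' => //; case: (mn _ sS).
    have [x [sx Es /fE[_ _ [s' [s'S Es' _]]]]] := act_top sp vf E.
    by have -> : s = s' by apply: node_seq_inj; rewrite Es Es'.
  by apply/eqP; rewrite memE //; case: (mn _ sS).
rewrite PE /family minsE; apply: eq_in_imset => s sS.
by apply/setP=> u; rewrite [RHS]inE memE.
Qed.

End Spaces.
End Families.

(* A coloring of the collections in in_U k is given as the restriction of a
   function on all sets of subsets of b^{<n}; only its values on in_U k matter. *)
Theorem theorem4 (k m b r : nat)
    (hk : 0 < k) (hm : 0 < m) (hb : 0 < b) (hr : 0 < r) (hkm : k <= m) :
  exists n0 : nat, 0 < n0 /\
    forall n : nat, n0 <= n ->
    forall c : {set {set node b n}} -> 'I_r,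
    exists U : {set {set node b n}},
      in_U m U /\
      exists i : 'I_r,
        forall P : {set {set node b n}}, in_U_of k U P -> c P = i.
Proof.
case: b hb => // b _; have [N HN] := tree_ramsey b 'I_r m hk.
(* The successor makes [n0] positive. *)
exists N.+1; split=> // n /ltnW Nn c.
have [tau [G [i [sp inc col]]]] := HN (fun z => c (family n z)).
exists (family n (act tau G (all_self m))); split; first exact: (family_in_U hm sp Nn inc).
exists i => P /(subspace_family sp Nn inc hk)[f [s [vf sf sh sbf ->]]].
exact: col sf sh sbf.
Qed.
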